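(* Let $p\ge 1$ be an integer and $\gamma\in\mathbb{R}$. Consider the $p$-th order CIP-FEM with penalty parameter $\gamma$ for the one-dimensional homogeneous Helmholtz equation $-u''-k^2u=0$ on $\mathbb{R}$, on the uniform mesh of size $h$, and let $\mathcal{D}$ be the $p\times p$ coefficient matrix described in the context. There exists a constant $C_0>0$ such that if $\frac{kh}{p}\le C_0$, then there is a discrete wave number $k_h>0$, i.e. a solution of $\det(\mathcal{D})=0$, for which the phase difference satisfies $$|k-k_h|=\frac12\left|\frac{1}{2p+1}\left[\frac{p!}{(2p)!}\right]^2+\gamma\right|k^{2p+1}h^{2p}+\mathcal{O}(k^{2p+3}h^{2p+2}).$$ As a consequence, taking the penalty parameter as $$\gamma=\gamma_0=-\frac{1}{2p+1}\left[\frac{p!}{(2p)!}\right]^2$$ reduces the phase difference of the CIP-FEM to $|k-k_h|=\mathcal{O}(k^{2p+3}h^{2p+2})$.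
   Context: Let $k>0$ be the wave number and $h>0$ the mesh size. The mesh of $\mathbb{R}$ consists of the intervals $[(j-1)h,jh]$, $j\in\mathbb{Z}$. $V_h$ is the space of continuous functions on $\mathbb{R}$ whose restriction to each mesh interval is a polynomial of degree $\le p$. Its nodes are $x_m=mh/p$, $m\in\mathbb{Z}$, and $\phi_m\in V_h$ is the nodal basis function with $\phi_m(x_n)=\delta_{mn}$. For functions $u,v$ in $V_h$, at least one of compact support, $$\mathcal{A}_\gamma(u,v)=\int_{\mathbb{R}}(u'v'-k^2uv)\,dx+\gamma h^{2p-1}\sum_{j\in\mathbb{Z}}[u^{(p)}]_{jh}\,[v^{(p)}]_{jh},$$ where $[w]_{jh}=w(jh^-)-w(jh^+)$ is the jump at the mesh point $jh$ and $u^{(p)}$ is taken elementwise. The CIP-FEM solution $u_h\in V_h$ (source-free problem) satisfies $\mathcal{A}_\gamma(u_h,v_h)=0$ for all compactly supported $v_h\in V_h$. One seeks solutions satisfying the Bloch wave condition $u_h(x+mh)=e^{\mathbf{i}mk_hh}u_h(x)$ for all $m\in\mathbb{Z}$, where $\mathbf{i}=\sqrt{-1}$. Testing with $\phi_0,\dots,\phi_{p-1}$ and using the Bloch condition gives a linear system $\mathcal{D}\mathbf{U}=0$ for $\mathbf{U}=(u_h(x_0),\dots,u_h(x_{p-1}))^T$, with $p\times p$ matrix $$\mathcal{D}_{s+1,q+1}=\sum_{m\in\mathbb{Z}}e^{\mathbf{i}mk_hh}\mathcal{A}_\gamma(\phi_{q+mp},\phi_s),\qquad 0\le s,q\le p-1$$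 (a finite sum). A discrete wave number $k_h$ is a solution of $\det(\mathcal{D})=0$, and $|k-k_h|$ is the phase difference. The constant $C_0$ and the constants implied in $\mathcal{O}(\cdot)$ are independent of $k$ and $h$ (they may depend on $p$ and $\gamma$). *)

(* Defs.v *)
From HB Require Import structures.
From mathcomp Require Import all_boot all_order all_algebra.
From mathcomp Require Import all_classical all_reals all_analysis.
From mathcomp Require Export complex.

Set Implicit Arguments.
Unset Strict Implicit.
Unset Printing Implicit Defensive.

Import Order.TTheory GRing.Theory Num.Theory.
Import numFieldNormedType.Exports.

Local Open Scope classical_set_scope.
Local Open Scope ring_scope.
Local Open Scope complex_scope.

Definition fem_space (R : realType) (p : nat) (h : R) : set (R -> R) :=
  [set u | continuous u /\
    forall j : int, exists q : {poly R}, (size q <= p.+1)%N /\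
      forall x : R, (j - 1)%:~R * h <= x <= j%:~R * h -> u x = q.[x]].

Definition fem_node (R : realType) (p : nat) (h : R) (m : int) : R :=
  m%:~R * h / p%:R.

(* phi_m, selected by its defining property; the default value 0 is not used
   when 0 < p and 0 < h, since then exactly one function has that property. *)
Definition nodal_basis (R : realType) (p : nat) (h : R) (m : int) : R -> R :=
  xget (fun=> 0) [set u | fem_space p h u /\
    forall n : int, u (fem_node p h n) = (m == n)%:R].

Definition jump (R : realType) (w : R -> R) (a : R) : R :=
  lim (w x @[x --> a^'-]) - lim (w x @[x --> a^'+]).

(* For u in V_h the library derivatives coincide with the elementwise ones off
   the mesh points. Their values at the mesh points affect neither the integral
   nor the one-sided limits. The sum over j has finite support as soon as u or
   v has compact support. *)
Definition cip_form (R : realType) (p : nat) (gamma k h : R) (u v : R -> R)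
    : R :=
  (\int[lebesgue_measure]_(x in [set: R])
     (derive1 u x * derive1 v x - k ^+ 2 * (u x * v x)))
  + gamma * h ^+ (2 * p - 1)%N *
    \sum_(j \in [set: int])
       (jump (derive1n p u) (j%:~R * h) * jump (derive1n p v) (j%:~R * h)).

Definition expi (R : realType) (t : R) : R[i] := cos t +i* sin t.

Definition cip_matrix (R : realType) (p : nat) (gamma k h kh : R)
    : 'M[R[i]]_p :=
  \matrix_(s < p, q < p)
    \sum_(m \in [set: int])
       expi (m%:~R * kh * h) *
       (cip_form p gamma k h (nodal_basis p h (q%:Z + m * p%:Z))
                             (nodal_basis p h s%:Z))%:C.

Definition discrete_wave_number (R : realType) (p : nat) (gamma k h kh : R)
    : Prop :=
  \det (cip_matrix p gamma k h kh) = 0.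

Definition gamma0 (R : realType) (p : nat) : R :=
  - ((2 * p + 1)%:R^-1 * ((p`!)%:R / ((2 * p)`!)%:R) ^+ 2).

(* Main.v *)
Require Import Defs.
From HB Require Import structures.
From mathcomp Require Import all_boot all_order all_algebra.
From mathcomp Require Import all_classical all_reals all_analysis.
From mathcomp Require Import measurable_realfun polyrcf qpoly.
From mathcomp Require Import ring lra zify.

(** The phase difference is read off from a real function of the discrete wave
number whose zeros are discrete wave numbers and which is known up to a small
error.

Scaling by [h] turns every mesh cell into [[0, 1]]; put [t = k h] and
[th = kh h].  A Bloch wave is determined by its restriction [W] to one cell, a
polynomial of degree at most [p] with [W(1) = e^{i th} W(0)], and the jump of
its [p]-th derivative at a mesh point is a multiple of the constant [W^(p)], by
a factor of modulus [|1 - e^{i th}|].  Hence the system [D U = 0] says that [W]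
is orthogonal to all quasi-periodic [V] for the Hermitian form
[int W' V'^* - t^2 int W V^* + gamma (2 - 2 cos th) W^(p) V^(p)^*]
([cip_matrix_row]).

The polynomials that vanish at both ends of the cell are called bubbles here.
When [t] and [th] are small the form is coercive on them, whatever the sign of
[gamma], because the penalty carries the factor [2 - 2 cos th].  So given end
values have a unique extension [W] that is orthogonal to the bubbles, only one
scalar condition is left, and it reads [S(th) = 0], where [S(th)] is the value
of the form at [W] normalised by [|W(0)| = 1] ([discrete_mode_det]).

To expand [S], compare [W] with [w = e - eta], where [e] is the exact wave
[e^{i th (x - 1/2)}] and [eta] vanishes at the ends.  Without penalty [e] has
energy [th^2 - t^2].  Take for [eta] the leading part of the best approximation
error, [(i th)^(p+1)] times a primitive of the Legendre polynomial of degree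
[p].  By orthogonality of Legendre polynomials [w] is then orthogonal to the
bubbles up to [O(th^(p+2))] ([trial_residual]).  Energies differ by the square
of that ([harmonic_gap]), so [S] may be computed at [w].  The energy of [eta] is
[th^(2p+2)] times the squared norm of the normalised Legendre polynomial, which
is the constant [1/(2p+1) (p!/(2p)!)^2] ([bump_energy]), and the penalty adds
[gamma th^(2p+2)].  Terms of order [th^(2p+3)] are absent because consecutive
Taylor terms of [e] differ by a factor [i], so that they live in different
components of the complex plane.  Altogether ([trial_energy])
[S(th) = th^2 - t^2 + (1/(2p+1) (p!/(2p)!)^2 + gamma) th^(2p+2)] up to
[O(th^(2p+4) + |th^2 - t^2| th^2)].

By the intermediate value theorem [S] has a zero with
[th^2 = t^2 - (1/(2p+1) (p!/(2p)!)^2 + gamma) t^(2p+2) + O(t^(2p+4))]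
([discrete_root]), and taking square roots gives the phase difference.

In the proof every integral over a cell is an algebraic functional on
polynomials, a complex polynomial is a pair [(u, v)] of real ones that stands
for [u - i v], and the exponential is replaced by Taylor polynomials of
[cos (x + j pi / 2)].  *)

Set Implicit Arguments.
Unset Strict Implicit.
Unset Printing Implicit Defensive.

Import Order.TTheory GRing.Theory Num.Theory.
Import numFieldNormedType.Exports.
Local Open Scope ring_scope.

(** * Integration of polynomials over [0, 1] *)

Section PolyInt.
Variable R : rcfType.
Implicit Types (p q u v b : {poly R}) (n m : nat).

Lemma size_derivn_leq n m q : (size q <= n + m)%N -> (size q^`(n) <= m)%N.
Proof.
move=> /leq_sizeP qnm; apply/leq_sizeP => i mi.
by rewrite coef_derivn qnm ?mul0rn // leq_add2l.
Qed.

Lemma derivn_eq0_size n q : q^`(n) = 0 -> (size q <= n)%N.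
Proof.
move=> qn; apply/leq_sizeP => i ni; have /polyP/(_ (i - n)%N) := qn.
rewrite coef_derivn coef0 subnKC // => /eqP.
by rewrite mulrn_eq0 eqn0Ngt ffact_gt0 ni => /eqP.
Qed.

Definition poly_int q : R := \sum_(i < size q) q`_i / i.+1%:R.

Lemma poly_int_wide n q : (size q <= n)%N ->
  poly_int q = \sum_(i < n) q`_i / i.+1%:R.
Proof.
move=> qn; rewrite /poly_int (big_ord_widen n (fun i => q`_i / i.+1%:R)) //.
rewrite big_mkcond; apply: eq_bigr => i _; case: ltnP => // /(nth_default 0) ->.
by rewrite mul0r.
Qed.

Fact poly_int_is_linear : scalar poly_int.
Proof.
move=> a u v; set n := maxn (size (a *: u + v)) (maxn (size u) (size v)).
rewrite !(@poly_int_wide n) ?leq_max ?leqnn ?orbT // mulr_sumr -big_split /=.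
by apply: eq_bigr => i _; rewrite coefD coefZ mulrDl mulrA.
Qed.
HB.instance Definition _ :=
  GRing.isLinear.Build R {poly R} R _ poly_int poly_int_is_linear.

Lemma poly_intD u v : poly_int (u + v) = poly_int u + poly_int v.
Proof. exact: linearD. Qed.

Lemma poly_intB u v : poly_int (u - v) = poly_int u - poly_int v.
Proof. exact: linearB. Qed.

Lemma poly_intZ (c : R) u : poly_int (c *: u) = c * poly_int u.
Proof. exact: linearZ. Qed.

Lemma poly_int_deriv q : poly_int q^`() = q.[1] - q.[0].
Proof.
rewrite horner_coef0 (@poly_int_wide (size q)); last first.
  by rewrite -derivn1 size_derivn_leq // addnC addn1.
have [->|q0] := eqVneq q 0; first by rewrite size_poly0 big_ord0 horner0 coef0 subrr.
rewrite horner_coef -[size q]prednK ?size_poly_gt0 //.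
rewrite [in RHS]big_ord_recl /= expr0 mulr1 addrC addrA addNr add0r.
rewrite big_ord_recr /= coef_deriv prednK ?size_poly_gt0 //.
rewrite nth_default // mul0rn mul0r addr0; apply: eq_bigr => i _.
by rewrite coef_deriv expr1n mulr1 -[_`_i.+1 *+ _]mulr_natr mulfK // pnatr_eq0.
Qed.

Lemma poly_int_parts u v : poly_int (u^`() * v) =
  u.[1] * v.[1] - u.[0] * v.[0] - poly_int (u * v^`()).
Proof.
have := poly_int_deriv (u * v).
by rewrite derivM linearD /= !hornerM => <-; rewrite addrK.
Qed.

Definition antideriv q : {poly R} := \poly_(i < (size q).+1) (q`_i.-1 / i%:R).

Lemma antiderivK q : (antideriv q)^`() = q.
Proof.
apply/polyP => i; rewrite coef_deriv coef_poly ltnS /=.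
case: ltnP => [_|/(nth_default 0) ->]; last by rewrite mul0rn.
by rewrite -[_ *+ _]mulr_natr mulfVK // pnatr_eq0.
Qed.

(** An antiderivative of [q] is nondecreasing on the interval, by the mean value
    theorem for polynomials. *)
Lemma poly_int_ge0 q : (forall x, 0 <= x <= 1 -> 0 <= q.[x]) -> 0 <= poly_int q.
Proof.
move=> q0; rewrite -(antiderivK q) poly_int_deriv subr_ge0.
have in01 (x : R) : x \in `[0, 1] = (0 <= x <= 1) by rewrite in_itv.
apply: (@ler_hornerW _ 0 1); rewrite ?in01 ?lexx ?ler01 // => x.
rewrite in_itv /= => /andP[x0 x1]; rewrite antiderivK q0 //.
by rewrite (ltW x0) (ltW x1).
Qed.

Lemma poly_int_le u v : (forall x, 0 <= x <= 1 -> u.[x] <= v.[x]) ->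
  poly_int u <= poly_int v.
Proof.
move=> uv; rewrite -subr_ge0 -linearB; apply: poly_int_ge0 => x x01.
by rewrite !hornerE subr_ge0 uv.
Qed.

Lemma poly_intC (c : R) : poly_int c%:P = c.
Proof.
by rewrite (poly_int_wide (size_polyC_leq1 c)) big_ord1 coefC /= divr1.
Qed.

Lemma poly_int_sup q (M : R) : (forall x, 0 <= x <= 1 -> `|q.[x]| <= M) ->
  `|poly_int q| <= M.
Proof.
move=> qM; rewrite ler_norml; apply/andP.
split; [rewrite -(poly_intC (- M)) | rewrite -(poly_intC M)];
  by apply: poly_int_le => x /qM; rewrite ler_norml hornerC => /andP[].
Qed.

Lemma poly_int_sqr_ge0 u : 0 <= poly_int (u ^+ 2).
Proof. by apply: poly_int_ge0 => x _; rewrite horner_exp sqr_ge0. Qed.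

(** The quadratic polynomial [s -> poly_int ((s u + v)^2)] is nonnegative, so its
    discriminant is not positive. *)
Lemma poly_int_CS u v :
  poly_int (u * v) ^+ 2 <= poly_int (u ^+ 2) * poly_int (v ^+ 2).
Proof.
set a := poly_int (u ^+ 2); set c := poly_int (v ^+ 2); set b := poly_int _.
have a0 : 0 <= a by exact: poly_int_sqr_ge0.
have c0 : 0 <= c by exact: poly_int_sqr_ge0.
have H s : 0 <= s ^+ 2 * a + 2 * s * b + c.
  have := poly_int_sqr_ge0 (s *: u + v).
  rewrite (_ : _ ^+ 2 = s ^+ 2 *: u ^+ 2 + (2 * s) *: (u * v) + v ^+ 2) ?linearD ?linearZ //=.
  by rewrite -!mul_polyC polyC_exp polyCM; ring.
have [az|an0] := eqVneq a 0.
  have [->|bn0] := eqVneq b 0; first by rewrite expr0n /= az mul0r.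
  have := H (- (c + 1) / (2 * b)); rewrite az mulr0 add0r.
  rewrite (_ : _ * b = - (c + 1)); last by field.
  by lra.
have := H (- b / a).
rewrite (_ : _ + c = (a * c - b ^+ 2) / a); last by field.
by rewrite pmulr_lge0 ?invr_gt0 ?lt0r ?an0 // subr_ge0.
Qed.

(** One integration by parts trades a factor [1 - 'X] for a factor ['X]. *)
Lemma poly_int_beta n m : poly_int ('X^n * (1 - 'X) ^+ m) =
  (n`! * m`!)%:R / (n + m).+1`!%:R.
Proof.
elim: m n => [|m IH] n.
  rewrite expr0 mulr1 addn0 fact0 muln1 (@poly_int_wide n.+1) ?size_polyXn //.
  rewrite big_ord_recr /= big1 ?add0r => [|i _]; last first.
    by rewrite coefXn ltn_eqF ?mul0r.
  rewrite coefXn eqxx factS natrM -[true%:R]/(1 : R).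
  by field; rewrite nat1r !pnatr_eq0 -lt0n fact_gt0.
set rhs := RHS; have n1 : n.+1%:R != 0 :> R by rewrite pnatr_eq0.
have := poly_int_parts 'X^(n.+1) ((1 - 'X) ^+ m.+1).
rewrite derivXn /= !hornerE /= !expr0n /= subrr expr0n /= mulr0 mul0r subrr sub0r.
rewrite deriv_exp derivB derivX -{2}polyC1 derivC sub0r mulN1r /=.
rewrite -[_ *+ n.+1]scaler_nat -scalerAl linearZ => /(canRL (mulKf n1)) ->.
rewrite mulNrn (mulrN 'X^(n.+1)) linearN opprK -[_ *+ m.+1]scaler_nat -scalerAr linearZ /= IH.
rewrite /rhs addSnnS.
have F0 : (n + m.+1).+1`!%:R != 0 :> R by rewrite pnatr_eq0 -lt0n fact_gt0.
move: ((n + m.+1).+1`!%:R) F0 => F F0.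
rewrite [n.+1`!]factS [m.+1`!]factS !natrM; field.
by rewrite F0 nat1r n1.
Qed.

End PolyInt.

(** * Legendre polynomials *)

Section Legendre.
Variable R : rcfType.
Implicit Types (p q u v b : {poly R}) (n m : nat).

Definition rodrigues n : {poly R} := ('X * ('X - 1)) ^+ n.

(** Each derivative of a power loses one factor of the base only. *)
Lemma derivn_exp_factor u n m : (m <= n)%N ->
  exists q, (u ^+ n)^`(m) = u ^+ (n - m) * q.
Proof.
elim: m => [|m IH] mn; first by exists 1; rewrite subn0 mulr1 derivn0.
have [q Eq] := IH (ltnW mn); exists (u^`() * q *+ (n - m) + u * q^`()).
rewrite derivnS Eq derivM deriv_exp -subnS.
have -> : u ^+ (n - m) = u * u ^+ (n - m.+1) by rewrite -exprS subnSK.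
by rewrite -[_ *+ (n - m)]mulr_natr -[_ *+ (n - m)]mulr_natr; ring.
Qed.

Lemma rodrigues_derivn_end n m : (m < n)%N ->
  ((rodrigues n)^`(m)).[0] = 0 /\ ((rodrigues n)^`(m)).[1] = 0.
Proof.
move=> mn; have [q ->] := derivn_exp_factor ('X * ('X - 1)) (ltnW mn).
by rewrite !(hornerE, mul0r, subrr, mulr0, expr0n) subn_eq0 leqNgt mn ?mul0r.
Qed.

Lemma monic_rodrigues n : rodrigues n \is monic.
Proof. by rewrite monic_exp // monicMl ?monicX // -polyC1 monicXsubC. Qed.

Lemma size_rodrigues n : size (rodrigues n) = n.*2.+1.
Proof.
rewrite /rodrigues my_size_exp; last first.
  by rewrite monic_neq0 // monicMl ?monicX // -polyC1 monicXsubC.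
rewrite size_monicM ?monicX ?size_polyX -?polyC1 ?size_XsubC //=.
  by rewrite mul2n.
by rewrite polyXsubC_eq0.
Qed.

Lemma monic_derivn n q : q \is monic -> size q = n.+1 -> q^`(n) = n`!%:R%:P.
Proof.
move=> /monicP q1 sq; have s1 : (size q^`(n) <= 1)%N.
  by rewrite size_derivn_leq // sq addn1.
rewrite (size1_polyC s1) coef_derivn addn0 ffactnn.
by move: q1; rewrite /lead_coef sq /= => ->.
Qed.

(** Rodrigues' formula for the shifted Legendre polynomial, without its usual
    normalising factor. *)
Definition legendre n : {poly R} := (rodrigues n)^`(n).

Lemma legendre_derivn n : (legendre n)^`(n) = (2 * n)`!%:R%:P.
Proof.
rewrite /legendre /derivn -iterD -/(derivn _ _) addnn mul2n.
by rewrite (monic_derivn (monic_rodrigues n)) // size_rodrigues.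
Qed.

(** Integration by parts [n] times; no boundary terms appear because the
    derivatives of [rodrigues n] of order below [n] vanish at both ends. *)
Lemma poly_int_legendre n u :
  poly_int (legendre n * u) = (-1) ^+ n * poly_int (rodrigues n * u^`(n)).
Proof.
suff H m : (m <= n)%N -> poly_int (legendre n * u) =
    (-1) ^+ m * poly_int ((rodrigues n)^`(n - m) * u^`(m)).
  by rewrite (H n) // subnn.
elim: m => [|m IH] mn; first by rewrite subn0 expr0 mul1r derivn0.
rewrite IH ?(ltnW mn) // -subnSK // derivnS poly_int_parts -derivnS.
have [-> ->] := @rodrigues_derivn_end n (n - m.+1) ltac:(lia).
by rewrite !mul0r subrr sub0r exprS mulrN !mulNr mul1r.
Qed.

Lemma legendre_orth n u : (size u <= n)%N -> poly_int (legendre n * u) = 0.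
Proof.
move=> un; rewrite poly_int_legendre derivn_poly0 //.
by rewrite mulr0 linear0 mulr0.
Qed.

(** The absolute value of the integral of [rodrigues n]. *)
Definition rod_mass n : R := n`!%:R ^+ 2 / (2 * n).+1`!%:R.

Lemma rod_mass_gt0 n : 0 < rod_mass n.
Proof. by rewrite divr_gt0 ?exprn_gt0 // ltr0n fact_gt0. Qed.

Lemma poly_int_legendre_top n u : (size u <= n.+1)%N ->
  poly_int (legendre n * u) = rod_mass n * u^`(n).[0].
Proof.
move=> un; rewrite poly_int_legendre.
have /size1_polyC -> : (size u^`(n) <= 1)%N by rewrite size_derivn_leq ?addn1.
rewrite hornerC mulrC [rodrigues n * _]mulrC mul_polyC linearZ /=.
rewrite [_ * (-1) ^+ n]mulrC mulrCA mulrC; congr (_ * _).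
rewrite (_ : rodrigues n = (-1) ^+ n *: ('X^n * (1 - 'X) ^+ n)); last first.
  by rewrite -exprMn -exprZn scaleN1r -mulrN opprB.
rewrite linearZ /= mulrA -expr2 sqrr_sign mul1r poly_int_beta natrM.
by rewrite /rod_mass expr2 addnn mul2n.
Qed.

(** Testing against the Legendre polynomial of degree [n] isolates the coefficient
    of degree [n]; the Cauchy-Schwarz inequality does the rest. *)
Lemma derivn_bound n : exists2 K : R, 0 < K & forall u, (size u <= n.+1)%N ->
  u^`(n).[0] ^+ 2 <= K * poly_int (u ^+ 2).
Proof.
have s0 := rod_mass_gt0 n; set s := rod_mass n in s0.
exists (poly_int (legendre n ^+ 2) / s ^+ 2).
  rewrite divr_gt0 ?exprn_gt0 // expr2 poly_int_legendre_top ?legendre_derivn.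
    by rewrite hornerC mulr_gt0 // ltr0n fact_gt0.
  by rewrite size_derivn_leq // size_rodrigues -addnn addnS.
move=> u un; rewrite mulrAC ler_pdivlMr ?exprn_gt0 // -exprMn mulrC.
by rewrite -poly_int_legendre_top // poly_int_CS.
Qed.

(** By [derivn_bound] the leading coefficient would vanish. *)
Lemma poly_int_sqr_eq0 u : poly_int (u ^+ 2) = 0 -> u = 0.
Proof.
move=> u0; apply/eqP; rewrite -size_poly_leq0; move Em: (size u) => m.
case: m Em => // m Em; have [K K0 /(_ u)] := derivn_bound m.
rewrite Em leqnn u0 mulr0 => /(_ isT) => H.
have /eqP : u^`(m).[0] ^+ 2 = 0.
  by apply/eqP; rewrite eq_le H sqr_ge0.
rewrite sqrf_eq0 horner_coef0 coef_derivn addn0 ffactnn mulrn_eq0.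
rewrite eqn0Ngt fact_gt0 /= -[m]/(m.+1.-1) -Em.
by rewrite -lead_coefE lead_coef_eq0 => /eqP u00; rewrite u00 size_poly0 in Em.
Qed.

End Legendre.

(** * The bilinear form of one cell and its bubbles *)

Section Form.
Variables (R : rcfType) (p : nat).
Implicit Types (u v w b : {poly R}) (t mu a : R).

(** On polynomials of degree at most [p] the [p]-th derivative is constant, and
    its value at [0] is that constant. *)
Definition top_coef u : R := u^`(p).[0].

Fact top_coef_is_linear : scalar top_coef.
Proof. by move=> a u v; rewrite /top_coef derivnD derivnZ !hornerE. Qed.
HB.instance Definition _ :=
  GRing.isLinear.Build R {poly R} R _ top_coef top_coef_is_linear.

(** The bilinear form of the method on the reference cell: [t] stands for [k h],
    and [mu] collects the penalty parameter and the Bloch phase. *)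
Definition ref_form t mu u v : R :=
  poly_int (u^`() * v^`()) - t ^+ 2 * poly_int (u * v)
  + mu * (top_coef u * top_coef v).

Lemma ref_formC t mu u v : ref_form t mu u v = ref_form t mu v u.
Proof.
by rewrite /ref_form [u^`() * _]mulrC [u * _]mulrC [top_coef u * _]mulrC.
Qed.

Fact ref_form_is_linear t mu u : scalar (ref_form t mu u).
Proof.
move=> a v w.
have E (x y z : {poly R}) :
    poly_int (x * (a *: y + z)) = a * poly_int (x * y) + poly_int (x * z).
  by rewrite mulrDr -scalerAr poly_intD poly_intZ.
have T : top_coef (a *: v + w) = a * top_coef v + top_coef w by exact: linearP.
by rewrite /ref_form derivD derivZ !E T; ring.
Qed.
HB.instance Definition _ t mu u :=
  GRing.isLinear.Build R {poly R} R _ (ref_form t mu u) (ref_form_is_linear t mu u).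

Lemma ref_formDl t mu u v w :
  ref_form t mu (u + v) w = ref_form t mu u w + ref_form t mu v w.
Proof. by rewrite ![ref_form _ _ _ w]ref_formC linearD. Qed.

Lemma ref_formZl t mu a u w : ref_form t mu (a *: u) w = a * ref_form t mu u w.
Proof. by rewrite ![ref_form _ _ _ w]ref_formC linearZ. Qed.

Lemma ref_formBl t mu u v w :
  ref_form t mu (u - v) w = ref_form t mu u w - ref_form t mu v w.
Proof. by rewrite ![ref_form _ _ _ w]ref_formC linearB. Qed.

Lemma ref_form_mu t mu u v :
  ref_form t mu u v = ref_form t 0 u v + mu * (top_coef u * top_coef v).
Proof. by rewrite /ref_form mul0r addr0. Qed.

Definition bubble b := [/\ (size b <= p.+1)%N, b.[0] = 0 & b.[1] = 0].

Lemma bubbleP_lin a u v : bubble u -> bubble v -> bubble (a *: u + v).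
Proof.
move=> [su u0 u1] [sv v0 v1]; split; rewrite ?hornerE ?u0 ?v0 ?u1 ?v1 ?mulr0 ?addr0 //.
rewrite (leq_trans (size_polyD _ _)) // geq_max sv andbT.
by rewrite (leq_trans (size_scale_leq _ _)).
Qed.

Lemma bubble0 : bubble 0.
Proof. by split; rewrite ?size_poly0 ?horner0. Qed.

Lemma bubbleZ a u : bubble u -> bubble (a *: u).
Proof. by move=> bu; rewrite -[_ *: _]addr0; apply: bubbleP_lin bubble0. Qed.

Lemma bubbleD u v : bubble u -> bubble v -> bubble (u + v).
Proof. by move=> bu bv; rewrite -[u]scale1r; exact: bubbleP_lin. Qed.

Lemma bubble_sum (I : Type) (r : seq I) (F : I -> {poly R}) :
  (forall i, bubble (F i)) -> bubble (\sum_(i <- r) F i).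
Proof. by move=> bF; apply: big_ind => //; [exact: bubble0 | exact: bubbleD]. Qed.

(** Expand the nonnegative integral of [(b' + (2x - 1) b)^2]: its mixed term
    integrates by parts to [- 2 b^2], and [(2x - 1)^2 <= 1] on the interval. *)
Lemma poincare b : b.[0] = 0 -> b.[1] = 0 ->
  poly_int (b ^+ 2) <= poly_int (b^`() ^+ 2).
Proof.
move=> b0 b1; pose y : {poly R} := 2 *: 'X - 1.
have H1 : poly_int (b ^+ 2 * 2%:P) = - poly_int (2%:P * b * b^`() * y).
  have := poly_int_parts (b ^+ 2) y.
  rewrite !horner_exp b0 b1 expr0n !mul0r subrr sub0r.
  rewrite (_ : y^`() = 2%:P); last first.
    by rewrite derivB derivZ derivX -polyC1 derivC subr0 -mul_polyC mulr1.
  move=> E; apply: oppr_inj; rewrite opprK -E; congr poly_int.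
  by rewrite expr2 derivM; ring.
have H2 := poly_int_sqr_ge0 (b^`() + y * b).
have H3 : 0 <= poly_int ((1 - y ^+ 2) * b ^+ 2).
  apply: poly_int_ge0 => x /andP[x0 x1]; rewrite !(hornerE, horner_exp) /=.
  rewrite -mulrA -expr2; apply: mulr_ge0; last exact: sqr_ge0.
  by have := mulr_ge0 x0 (_ : 0 <= 1 - x); rewrite subr_ge0 => /(_ x1); nra.
have E : b^`() ^+ 2 - b ^+ 2 = (b^`() + y * b) ^+ 2 + (1 - y ^+ 2) * b ^+ 2
   - (b ^+ 2 * 2%:P + 2%:P * b * b^`() * y) by ring.
rewrite -subr_ge0 -linearB E linearB linearD /= [poly_int (_ + _ * y)]linearD /=.
by rewrite H1 addNr subr0 addr_ge0.
Qed.

Lemma bubble_deriv_eq0 b : bubble b -> poly_int (b^`() ^+ 2) = 0 -> b = 0.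
Proof.
move=> [_ b0 b1] H; apply: poly_int_sqr_eq0; apply/eqP.
by rewrite eq_le poly_int_sqr_ge0 andbT -[X in _ <= X]H poincare.
Qed.

Lemma top_coef_bound : (0 < p)%N -> exists2 K : R, 0 < K &
  forall b, (size b <= p.+1)%N -> top_coef b ^+ 2 <= K * poly_int (b^`() ^+ 2).
Proof.
move=> p0; have [K K0 HK] := derivn_bound R p.-1; exists K => // b sb.
rewrite /top_coef -(prednK p0) derivSn HK //.
by rewrite -derivn1 size_derivn_leq // add1n prednK.
Qed.

Let size_edge : size ('X * ('X - 1) : {poly R}) = 3%N.
Proof. by rewrite mulrC size_mulX -polyC1 ?polyXsubC_eq0 // size_XsubC. Qed.

Let monic_edge : 'X * ('X - 1) \is @monic R.
Proof. by rewrite monicMl ?monicX // -polyC1 monicXsubC. Qed.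

Definition bubble_basis (i : 'I_p.-1) : {poly R} := 'X * ('X - 1) * 'X^i.

Lemma bubble_basisP i : bubble (bubble_basis i).
Proof.
split; rewrite /bubble_basis ?(hornerE, mul0r, subrr, mulr0) //.
rewrite (leq_trans (size_polyMleq _ _)) // size_polyXn size_edge.
by have := ltn_ord i; lia.
Qed.

Lemma bubble_decomp b : bubble b ->
  exists c : 'I_p.-1 -> R, b = \sum_i c i *: bubble_basis i.
Proof.
move=> [sb /eqP b0 /eqP b1]; have /factor_theorem[q Eq] : root b 0 by [].
have /factor_theorem[r Er] : root q 1.
  by move: b1; rewrite Eq hornerM !hornerE subr0 mulr1.
have Eb : b = 'X * ('X - 1) * r by rewrite Eq Er subr0 polyC1; ring.
exists (fun i => r`_i); under eq_bigr do rewrite /bubble_basis scalerAr.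
rewrite -mulr_sumr Eb; congr (_ * _); rewrite -(poly_def _ (fun i => r`_i)).
have [->|r0] := eqVneq r 0.
  by apply/polyP => i; rewrite coef_poly coef0 if_same.
have sr : (size r <= p.-1)%N.
  by move: sb; rewrite Eb size_monicM // size_edge; case: (p) => [|m]; rewrite !addSn.
apply/polyP => i; rewrite coef_poly; case: ltnP => // ip.
by rewrite nth_default // (leq_trans sr).
Qed.

(** The Gram matrix of a basis of the bubbles has trivial kernel, so it can be
    solved for any right-hand side. *)
Lemma riesz t mu (f : {scalar {poly R}}) :
  (forall b, bubble b -> ref_form t mu b b = 0 -> b = 0) ->
  exists2 g, bubble g & forall b, bubble b -> ref_form t mu g b = f b.
Proof.
move=> def; pose G := \matrix_(i, j) ref_form t mu (bubble_basis i) (bubble_basis j).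
pose comb (z : 'rV[R]_p.-1) := \sum_i z 0 i *: bubble_basis i.
have bc z : bubble (comb z).
  by apply: bubble_sum => i; apply: bubbleZ; apply: bubble_basisP.
have GE z j : (z *m G) 0 j = ref_form t mu (comb z) (bubble_basis j).
  rewrite ref_formC linear_sum mxE; apply: eq_bigr => i _.
  by rewrite linearZ mxE ref_formC.
have Gu : G \in unitmx.
  rewrite unitmxE unitfE; apply/negP => /det0P[z zn0 zG0].
  have c0 : comb z = 0.
    apply: def => //; rewrite {2}/comb linear_sum big1 // => j _.
    by rewrite linearZ /= -GE zG0 mxE mulr0.
  case/negP: zn0; apply/eqP/rowP => i; rewrite mxE.
  have : 'X * ('X - 1) * \poly_(i < p.-1) (if insub i is Some j then z 0 j else 0) = 0 :> {poly R}.
    rewrite -c0 poly_def mulr_sumr; apply: eq_bigr => j _.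
    by rewrite /bubble_basis -scalerAr insubT //= => lt_j; congr (z 0 _ *: _); apply: val_inj.
  move/eqP; rewrite mulf_eq0 (negPf (monic_neq0 monic_edge)) /=.
  by move/eqP/polyP/(_ i); rewrite coef0 coef_poly ltn_ord valK.
pose r := \row_j f (bubble_basis j); exists (comb (r *m invmx G)) => // b bb.
have [c ->] := bubble_decomp bb; rewrite !linear_sum; apply: eq_bigr => j _.
by rewrite !linearZ /= -GE mulmxKV // mxE.
Qed.

End Form.

(** * Uniform bounds and the Taylor expansion of the cosine *)

Section BigO.
Variables (R : realType) (T : Type).
Implicit Types (D : T -> Prop) (f g : T -> R).

(** A bound uniform over the parameters in [D]; the constant is existential so
    that it need not be tracked. *)
Definition isO D g f := exists2 C : R, 0 <= C & forall z, D z -> `|f z| <= C * g z.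

Lemma isO_eq D g f1 f2 : isO D g f1 -> (forall z, D z -> f2 z = f1 z) ->
  isO D g f2.
Proof. by move=> [C C0 H] E; exists C => // z Dz; rewrite E // H. Qed.

Lemma isO_add D g f1 f2 : isO D g f1 -> isO D g f2 ->
  isO D g (fun z => f1 z + f2 z).
Proof.
move=> [C1 C10 H1] [C2 C20 H2]; exists (C1 + C2); first exact: addr_ge0.
move=> z Dz; rewrite (le_trans (ler_normD _ _)) // mulrDl.
by rewrite lerD ?H1 ?H2.
Qed.

Lemma isO_opp D g f : isO D g f -> isO D g (fun z => - f z).
Proof. by move=> [C C0 H]; exists C => // z Dz; rewrite normrN H. Qed.

Lemma isO_sub D g f1 f2 : isO D g f1 -> isO D g f2 ->
  isO D g (fun z => f1 z - f2 z).
Proof. by move=> H1 H2; apply: isO_add => //; exact: isO_opp. Qed.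

Lemma isO_mul D g1 g2 f1 f2 : isO D g1 f1 -> isO D g2 f2 ->
  isO D (fun z => g1 z * g2 z) (fun z => f1 z * f2 z).
Proof.
move=> [C1 C10 H1] [C2 C20 H2]; exists (C1 * C2); first exact: mulr_ge0.
move=> z Dz; rewrite normrM mulrACA; apply: ler_pM => //; [exact: H1|exact: H2].
Qed.

Lemma isO_gauge (K : R) D g1 g2 f : 0 <= K -> (forall z, D z -> g1 z <= K * g2 z) ->
  isO D g1 f -> isO D g2 f.
Proof.
move=> K0 g12 [C C0 H]; exists (C * K); first exact: mulr_ge0.
by move=> z Dz; rewrite (le_trans (H z Dz)) // -mulrA ler_wpM2l ?g12.
Qed.

Lemma isO_le D g1 g2 f : (forall z, D z -> g1 z <= g2 z) ->
  isO D g1 f -> isO D g2 f.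
Proof. by move=> g12; apply: (@isO_gauge 1) => // z Dz; rewrite mul1r g12. Qed.

Lemma isO_scale (c : R) D g f : isO D g f -> isO D g (fun z => c * f z).
Proof.
move=> [C C0 H]; exists (`|c| * C); first by rewrite mulr_ge0.
by move=> z Dz; rewrite normrM -mulrA ler_wpM2l ?H.
Qed.

Lemma isO_cst (c : R) D : isO D (fun=> 1) (fun=> c).
Proof. by exists `|c| => // z _; rewrite mulr1. Qed.

Lemma isO_self D g : (forall z, D z -> 0 <= g z) -> isO D g g.
Proof. by move=> g0; exists 1 => // z Dz; rewrite ger0_norm ?mul1r ?g0. Qed.

Lemma isO_zero D g : isO D g (fun=> 0).
Proof. by exists 0 => // z _; rewrite normr0 mul0r. Qed.

Lemma isO_sum D g (I : Type) (r : seq I) (F : I -> T -> R) :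
  (forall i, isO D g (F i)) -> isO D g (fun z => \sum_(i <- r) F i z).
Proof.
move=> H; elim: r => [|i r IH].
  by apply: isO_eq (isO_zero D g) _ => z _; rewrite big_nil.
by apply: isO_eq (isO_add (H i) IH) _ => z _; rewrite big_cons.
Qed.

(** A sum of powers of a quantity in [[0, 1]] whose first [m] coefficients vanish
    is of order [m]. *)
Lemma isO_tail D (th : T -> R) (c : nat -> T -> R) m N :
  (forall z, D z -> 0 <= th z <= 1) ->
  (forall n, isO D (fun=> 1) (c n)) -> (forall n z, (n < m)%N -> c n z = 0) ->
  isO D (fun z => th z ^+ m) (fun z => \sum_(n < N) th z ^+ n * c n z).
Proof.
move=> th01 cb c0; apply: isO_sum => n; have [nm|mn] := ltnP n m.
  by apply: isO_eq (isO_zero _ _) _ => z _; rewrite c0 ?mulr0.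
have H : isO D (fun z => th z ^+ n) (fun z => th z ^+ n).
  by apply: isO_self => z /th01 /andP[? _]; exact: exprn_ge0.
apply: isO_le (isO_mul H (cb n)) => z /th01 /andP[t0 t1].
by rewrite mulr1 -(subnKC mn) exprD ler_piMr ?exprn_ge0 ?exprn_ile1.
Qed.

End BigO.

Lemma isO_poly_int (R : realType) (T : Type) (D : T -> Prop) (g : T -> R)
    (F : T -> {poly R}) :
  isO (fun z : T * R => D z.1 /\ 0 <= z.2 <= 1) (fun z => g z.1)
      (fun z => (F z.1).[z.2]) ->
  isO D g (fun z => poly_int (F z)).
Proof.
move=> [C C0 H]; exists C => // z Dz.
by apply: poly_int_sup => x x01; exact: (H (z, x)).
Qed.

Section Trig.
Variable R : realType.
Implicit Types (x th : R) (j n N : nat).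

(** The [j]-th derivative of the cosine, or the real part of [i^j e^{i x}]. *)
Definition cosn j x : R := cos (x + j%:R * (pi / 2)).

Lemma cosn0 x : cosn 0 x = cos x.
Proof. by rewrite /cosn mul0r addr0. Qed.

Lemma cosnS j x : cosn j.+1 x = - sin (x + j%:R * (pi / 2)).
Proof. by rewrite /cosn -natr1 mulrDl mul1r addrA cosDpihalf. Qed.

Lemma cosnSS j x : cosn j.+2 x = - cosn j x.
Proof. by rewrite cosnS -natr1 mulrDl mul1r addrA sinDpihalf. Qed.

Lemma cosn_sqr j x : cosn j x ^+ 2 + cosn j.+1 x ^+ 2 = 1.
Proof. by rewrite cosnS sqrrN cos2Dsin2. Qed.

Lemma cosn_le1 j x : `|cosn j x| <= 1.
Proof. exact: cos_max. Qed.

Lemma is_derive_cosn j x : is_derive x 1 (cosn j) (cosn j.+1 x).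
Proof.
have -> : cosn j = cos \o (fun x => x + j%:R * (pi / 2)) by [].
rewrite cosnS.
have := @is_derive1_comp R cos (fun x => x + j%:R * (pi / 2)) x
  (- sin (x + j%:R * (pi / 2))) 1.
rewrite mulr1; apply.
by have := is_deriveD (is_derive_id x 1) (is_derive_cst (j%:R * (pi / 2)) x 1);
  rewrite addr0.
Qed.

Lemma cosn_even_sqr n : cosn n.*2 0 ^+ 2 = 1 :> R.
Proof.
elim: n => [|n IH]; first by rewrite cosn0 cos0 expr1n.
by rewrite doubleS cosnSS sqrrN.
Qed.

Lemma cosn_odd n : cosn n.*2.+1 0 = 0 :> R.
Proof.
elim: n => [|n IH]; first by rewrite cosnS mul0r addr0 sin0 oppr0.
by rewrite doubleS cosnSS IH oppr0.
Qed.

Definition cos_taylor j N : {poly R} := \poly_(n < N) (cosn (n + j) 0 / n`!%:R).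

Lemma cos_taylor_deriv j N : (cos_taylor j N.+1)^`() = cos_taylor j.+1 N.
Proof.
apply/polyP => i; rewrite coef_deriv !coef_poly ltnS.
case: ltnP => _; last by rewrite mul0rn.
have F0 : i`!%:R != 0 :> R by rewrite pnatr_eq0 -lt0n fact_gt0.
rewrite addSnnS factS natrM -[_ *+ i.+1]mulr_natr; move: (i`!%:R) F0 => F F0.
by field; rewrite F0 nat1r pnatr_eq0.
Qed.

(** Induction on [N] with the mean value theorem: the remainder of order [N + 1]
    of [cosn j] has the remainder of order [N] of [cosn j.+1] as its derivative. *)
Lemma cos_taylor_bound j N x : `|cosn j x - (cos_taylor j N).[x]| <= `|x| ^+ N.
Proof.
elim: N j x => [|N IH] j x.
  by rewrite /cos_taylor poly_def big_ord0 horner0 subr0 expr0 cosn_le1.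
pose f x := cosn j x - (cos_taylor j N.+1).[x].
pose df x := cosn j.+1 x - (cos_taylor j.+1 N).[x].
have fd (y : R) : is_derive y 1 f (df y).
  apply: is_deriveB; first exact: is_derive_cosn.
  by rewrite -cos_taylor_deriv; exact: is_derive_poly.
have fc : continuous f.
  by move=> y; apply: differentiable_continuous; apply/derivable1_diffP; case: (fd y).
have f0 : f 0 = 0.
  by rewrite /f horner_coef0 coef_poly /= add0n fact0 divr1 subrr.
rewrite -/(f x); have [x0|x0|<-] := ltrgtP 0 x.
- have [c c0x] := MVT x0 (fun y _ => fd y) (continuous_subspaceT fc).
  rewrite f0 !subr0 => -> ; rewrite normrM exprSr ler_wpM2r //.
  rewrite (le_trans (IH _ _)) // lerXn2r ?nnegrE //.
  by move: c0x; rewrite in_itv /= => /andP[c0 cx]; rewrite !ger0_norm ?ltW.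
- have [c c0x] := MVT x0 (fun y _ => fd y) (continuous_subspaceT fc).
  rewrite f0 !sub0r => /(congr1 Num.norm); rewrite normrN => ->.
  rewrite normrM normrN exprSr ler_wpM2r // (le_trans (IH _ _)) //.
  rewrite lerXn2r ?nnegrE //.
  by move: c0x; rewrite in_itv /= => /andP[c0 cx]; rewrite !ltr0_norm ?lerN2 ?ltW.
- by rewrite f0 normr0 exprn_ge0.
Qed.

End Trig.

(** * The trial wave *)

Section Trial.
Variables (R : realType) (p : nat).
Implicit Types (x th : R) (j n m N : nat) (u : {poly R}).

(** The monomials of the Taylor expansion at the midpoint of the cell.  The
    midpoint makes the phase [e^{i th (x - 1/2)}] symmetric in the two ends. *)
Definition taylor_mon n : {poly R} := n`!%:R^-1 *: ('X - (2^-1)%:P) ^+ n.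

Lemma taylor_mon_deriv n : (taylor_mon n.+1)^`() = taylor_mon n.
Proof.
rewrite /taylor_mon derivZ deriv_exp derivXsubC mul1r -[_ *+ n.+1]scaler_nat scalerA factS /=.
by rewrite natrM invfM mulrC mulrA mulfV ?mul1r // pnatr_eq0.
Qed.

Lemma taylor_mon_derivn n m : (taylor_mon (n + m))^`(n) = taylor_mon m.
Proof.
by elim: n => [|n IH]; rewrite ?derivn0 ?derivSn ?addSn ?taylor_mon_deriv.
Qed.

Lemma taylor_mon0 : taylor_mon 0 = 1.
Proof. by rewrite /taylor_mon expr0 fact0 invr1 scale1r. Qed.

Lemma size_taylor_mon n : (size (taylor_mon n) <= n.+1)%N.
Proof.
rewrite (leq_trans (size_scale_leq _ _)) //.
by rewrite (leq_trans (size_poly_exp_leq _ _)) // size_XsubC mul1n.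
Qed.

Definition lin_interp (a b : R) : {poly R} := a%:P + (b - a) *: 'X.

Lemma lin_interp0 a b : (lin_interp a b).[0] = a.
Proof. by rewrite /lin_interp hornerD hornerC hornerZ hornerX mulr0 addr0. Qed.

Lemma lin_interp1 a b : (lin_interp a b).[1] = b.
Proof. by rewrite /lin_interp hornerD hornerC hornerZ hornerX mulr1 addrC subrK. Qed.

Lemma deriv_lin_interp a b : (lin_interp a b)^`() = (b - a)%:P.
Proof. by rewrite derivD derivC derivZ derivX add0r -mul_polyC mulr1. Qed.

Lemma size_lin_interp a b : (size (lin_interp a b) <= 2)%N.
Proof.
rewrite (leq_trans (size_polyD _ _)) // geq_max (leq_trans (size_polyC_leq1 _)) //=.
by rewrite (leq_trans (size_scale_leq _ _)) // size_polyX.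
Qed.

(** A primitive of the Legendre polynomial of degree [p], scaled so that its
    derivative of order [p + 1] is [1].  It has the leading term of [taylor_mon p.+1], it
    vanishes at both ends, and its derivative is orthogonal to lower degrees. *)
Definition bump : {poly R} := (2 * p)`!%:R^-1 *: (rodrigues R p)^`(p.-1).

(** What is subtracted from [taylor_mon n] to bring it into degree at most [p] without
    moving its end values.  In degree [p + 1] the remainder must be the optimal one;
    in higher degrees linear interpolation is good enough. *)
Definition corrector n : {poly R} :=
  if (n <= p)%N then 0 else if n == p.+1 then bump
  else taylor_mon n - lin_interp (taylor_mon n).[0] (taylor_mon n).[1].

Hypothesis p0 : (0 < p)%N.

Lemma bump_deriv : bump^`() = (2 * p)`!%:R^-1 *: legendre R p.
Proof. by rewrite derivZ -derivnS prednK. Qed.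

Lemma bump_orth u : (size u <= p)%N -> poly_int (bump^`() * u) = 0.
Proof.
by move=> up; rewrite bump_deriv -scalerAl linearZ /= legendre_orth ?mulr0.
Qed.

(** The source of the constant in the phase difference: the squared norm of the
    monic Legendre polynomial of degree [p], divided by [p!^2]. *)
Lemma bump_energy :
  poly_int (bump^`() ^+ 2) = (2 * p + 1)%:R^-1 * (p`!%:R / (2 * p)`!%:R) ^+ 2.
Proof.
have F0 : (2 * p)`!%:R != 0 :> R by rewrite pnatr_eq0 -lt0n fact_gt0.
have p10 : (2 * p + 1)%:R != 0 :> R by rewrite pnatr_eq0 addn1.
rewrite bump_deriv exprZn linearZ /= expr2 poly_int_legendre_top; last first.
  by rewrite size_derivn_leq // size_rodrigues -addnn addnS.
rewrite legendre_derivn hornerC /rod_mass factS natrM -[(2 * p).+1]addn1.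
move: ((2 * p)`!%:R) F0 => F F0; move: (p`!%:R) => G; move: ((2 * p + 1)%:R) p10 => q q0.
by field; rewrite F0 q0.
Qed.

Lemma bump_top : bump^`(p.+1) = 1.
Proof.
rewrite /bump derivnZ /derivn -iterD -/(derivn _ _).
have -> : (p.+1 + p.-1 = 2 * p)%N by lia.
rewrite (monic_derivn (monic_rodrigues R p)) ?size_rodrigues ?mul2n //.
by rewrite -mul_polyC -polyCM mulVf // pnatr_eq0 -lt0n fact_gt0.
Qed.

Lemma corrector_ends n : (corrector n).[0] = 0 /\ (corrector n).[1] = 0.
Proof.
rewrite /corrector; case: ifP => _; first by rewrite !horner0.
case: ifP => _; last by rewrite !hornerD !hornerN lin_interp0 lin_interp1 !subrr.
have [E0 E1] := @rodrigues_derivn_end R p p.-1 ltac:(lia).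
by rewrite !hornerZ E0 E1 mulr0.
Qed.

Lemma size_taylor_mon_corrector n : (size (taylor_mon n - corrector n)%R <= p.+1)%N.
Proof.
rewrite /corrector; case: ifP => np; first by rewrite subr0 (leq_trans (size_taylor_mon n)).
case: eqP => [->|_].
  apply: derivn_eq0_size; rewrite derivnB bump_top.
  by have := taylor_mon_derivn p.+1 0; rewrite addn0 => ->; rewrite taylor_mon0 subrr.
by rewrite subKr (leq_trans (size_lin_interp _ _)).
Qed.

Definition cos_series N j th : {poly R} :=
  \sum_(n < N) th ^+ n *: (cosn (n + j) 0 *: taylor_mon n).

Definition corrector_series N j th : {poly R} :=
  \sum_(n < N) th ^+ n *: (cosn (n + j) 0 *: corrector n).

Lemma horner_cos_series N j th x :
  (cos_series N j th).[x] = (cos_taylor R j N).[th * (x - 2^-1)].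
Proof.
rewrite horner_sum horner_poly; apply: eq_bigr => n _.
by rewrite !hornerZ horner_exp hornerXsubC exprMn; ring.
Qed.

Lemma cos_series_bound N j th x :
  `|cosn j (th * (x - 2^-1)) - (cos_series N j th).[x]|
    <= `|th * (x - 2^-1)| ^+ N.
Proof. by rewrite horner_cos_series cos_taylor_bound. Qed.

Lemma cos_series_deriv N j th :
  (cos_series N.+1 j th)^`() = th *: cos_series N j.+1 th.
Proof.
rewrite /cos_series big_ord_recl derivD expr0 scale1r derivZ taylor_mon0 -polyC1 derivC.
rewrite scaler0 add0r linear_sum scaler_sumr; apply: eq_bigr => n _ /=.
by rewrite derivZ derivZ taylor_mon_deriv exprS !scalerA addSnnS.
Qed.

(** A polynomial substitute for [cosn j (th (x - 1/2))].  A linear term makes the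
    end values exact, which the Bloch condition requires.  The length [2 p + 4] makes
    all truncation errors as small as the final error term. *)
Definition quasi_cos j th : {poly R} :=
  let u := cos_series (2 * p + 4) j th in
  u + lin_interp (cosn j (- (th / 2)) - u.[0]) (cosn j (th / 2) - u.[1]).

(** The real components [j = p + 1] and [j = p + 2] of the approximate wave in
    the space of polynomials of degree at most [p].  With this choice the term of
    degree [p + 1] of the exact wave lies in the first component alone. *)
Definition trial j th : {poly R} :=
  quasi_cos j th - corrector_series (2 * p + 4) j th.

Lemma corrector_series_ends N j th :
  (corrector_series N j th).[0] = 0 /\ (corrector_series N j th).[1] = 0.
Proof.
by split; rewrite /corrector_series horner_sum big1 // => n _;
  have [E0 E1] := corrector_ends n; rewrite !hornerZ ?E0 ?E1 !mulr0.
Qed.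

Lemma trial0 j th : (trial j th).[0] = cosn j (- (th / 2)).
Proof.
have [E _] := corrector_series_ends (2 * p + 4) j th.
by rewrite /trial hornerD hornerN E subr0 hornerD lin_interp0 addrC subrK.
Qed.

Lemma trial1 j th : (trial j th).[1] = cosn j (th / 2).
Proof.
have [_ E] := corrector_series_ends (2 * p + 4) j th.
by rewrite /trial hornerD hornerN E subr0 hornerD lin_interp1 addrC subrK.
Qed.

Lemma trialE j th : exists a b,
  trial j th = \sum_(n < 2 * p + 4) th ^+ n *: (cosn (n + j) 0 *: (taylor_mon n - corrector n))
               + lin_interp a b.
Proof.
pose u := cos_series (2 * p + 4) j th.
exists (cosn j (- (th / 2)) - u.[0]), (cosn j (th / 2) - u.[1]).
rewrite /trial /quasi_cos -/u addrAC; congr (_ + _).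
rewrite -sumrB; apply: eq_bigr => n _.
by rewrite -scalerBr -scalerBr.
Qed.

Lemma size_trial j th : (size (trial j th) <= p.+1)%N.
Proof.
have [a [b ->]] := trialE j th.
rewrite (leq_trans (size_polyD _ _)) // geq_max.
rewrite andbC (leq_trans (size_lin_interp _ _)) //=.
apply: (leq_trans (size_sum _ _ _)); apply/bigmax_leqP => n _.
rewrite (leq_trans (size_scale_leq _ _)) // (leq_trans (size_scale_leq _ _)) //.
exact: size_taylor_mon_corrector.
Qed.

End Trial.

(** * Size of the trial wave *)

Section Estimates.
Variables (R : realType) (p : nat).
Implicit Types (f g : R * R -> R) (F G : R * R -> {poly R}) (j n m N : nat).

(** Pairs [(th, t)].  The second inequality only asks [t] not to be much larger
    than [th]; the two are close in the application. *)
Definition wave_dom (z : R * R) : Prop := 0 < z.1 <= 1 /\ 0 < z.2 <= 2 * z.1.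
Definition wave_dom1 (z : (R * R) * R) : Prop := wave_dom z.1 /\ 0 <= z.2 <= 1.

Definition Otheta n f := isO wave_dom (fun z => z.1 ^+ n) f.
Definition OthetaX n (f : (R * R) * R -> R) := isO wave_dom1 (fun z => z.1.1 ^+ n) f.
Definition Opoly n F := OthetaX n (fun z => (F z.1).[z.2]).

Lemma wave_dom_th z : wave_dom z -> 0 <= z.1 <= 1.
Proof. by move=> [/andP[z0 z1] _]; rewrite ltW. Qed.

Lemma Otheta_weaken m n f : (m <= n)%N -> Otheta n f -> Otheta m f.
Proof.
move=> mn; apply: isO_le => z /wave_dom_th /andP[z0 z1].
by rewrite ler_wiXn2l.
Qed.

Lemma OthetaX_weaken m n (f : (R * R) * R -> R) : (m <= n)%N -> OthetaX n f -> OthetaX m f.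
Proof.
move=> mn; apply: isO_le => z [/wave_dom_th /andP[z0 z1] _].
by rewrite ler_wiXn2l.
Qed.

Lemma Otheta_mul n m f g : Otheta n f -> Otheta m g -> Otheta (n + m) (fun z => f z * g z).
Proof.
by move=> Hf Hg; apply: isO_le (isO_mul Hf Hg) => z _; rewrite exprD.
Qed.

Lemma OthetaX_mul n m (f g : (R * R) * R -> R) :
  OthetaX n f -> OthetaX m g -> OthetaX (n + m) (fun z => f z * g z).
Proof.
by move=> Hf Hg; apply: isO_le (isO_mul Hf Hg) => z _; rewrite exprD.
Qed.

Lemma Otheta_exp n : Otheta n (fun z => z.1 ^+ n).
Proof. by apply: isO_self => z /wave_dom_th /andP[z0 _]; exact: exprn_ge0. Qed.

Lemma Otheta_cst (c : R) : Otheta 0 (fun=> c).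
Proof. by apply: isO_le (isO_cst c _) => z _; rewrite expr0. Qed.

Lemma Otheta_t : Otheta 1 (fun z => z.2).
Proof.
exists 2 => // z [_ /andP[t0 t1]]; by rewrite expr1 ger0_norm // ltW.
Qed.

Lemma poly_bounded (q : {poly R}) : isO wave_dom1 (fun=> 1) (fun z => q.[z.2]).
Proof.
exists (\sum_(i < size q) `|q`_i|); first by rewrite sumr_ge0.
move=> z [_ /andP[z0 z1]]; rewrite mulr1 horner_coef.
rewrite (le_trans (ler_norm_sum _ _ _)) // ler_sum // => i _.
by rewrite normrM ler_piMr // normrX exprn_ile1 // ger0_norm.
Qed.

Lemma Opoly_eq n F G : (forall z, F z = G z) -> Opoly n F -> Opoly n G.
Proof. by move=> FG H; apply: isO_eq H _ => z _; rewrite FG. Qed.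

Lemma Opoly_add n F G : Opoly n F -> Opoly n G -> Opoly n (fun z => F z + G z).
Proof.
by move=> HF HG; apply: isO_eq (isO_add HF HG) _ => z _; rewrite hornerD.
Qed.

Lemma Opoly_mul n m F G : Opoly n F -> Opoly m G -> Opoly (n + m) (fun z => F z * G z).
Proof.
by move=> HF HG; apply: isO_eq (OthetaX_mul HF HG) _ => z _; rewrite hornerM.
Qed.

Lemma Opoly_cst (q : {poly R}) : Opoly 0 (fun=> q).
Proof. by apply: isO_le (poly_bounded q) => z _; rewrite expr0. Qed.

Lemma Opoly_C n f : Otheta n f -> Opoly n (fun z => (f z)%:P).
Proof. by move=> [C C0 H]; exists C => // z [Dz _]; rewrite hornerC H. Qed.

Lemma Opoly_scale n m f F : Otheta n f -> Opoly m F -> Opoly (n + m) (fun z => f z *: F z).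
Proof.
move=> Hf HF; apply: Opoly_eq (Opoly_mul (Opoly_C Hf) HF) => z.
by rewrite mul_polyC.
Qed.

Lemma Opoly_weaken m n F : (m <= n)%N -> Opoly n F -> Opoly m F.
Proof. exact: OthetaX_weaken. Qed.

Lemma Opoly_int n F : Opoly n F -> Otheta n (fun z => poly_int (F z)).
Proof. exact: isO_poly_int. Qed.

Lemma Opoly_series N m (d : nat -> {poly R}) : (forall n, (n < m)%N -> d n = 0) ->
  Opoly m (fun z => \sum_(n < N) z.1 ^+ n *: d n).
Proof.
move=> d0; have th01 (z : (R * R) * R) : wave_dom1 z -> 0 <= z.1.1 <= 1.
  by move=> [/wave_dom_th].
apply: isO_eq (@isO_tail _ _ _ (fun z => z.1.1) (fun n z => (d n).[z.2]) m N
   th01 (fun n => poly_bounded (d n)) _) _.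
  by move=> n z /d0 ->; rewrite horner0.
by move=> z _; rewrite horner_sum; apply: eq_bigr => i _; rewrite hornerZ.
Qed.

Lemma Otheta_series N m (c : nat -> R) : (forall n, (n < m)%N -> c n = 0) ->
  Otheta m (fun z => \sum_(n < N) z.1 ^+ n * c n).
Proof.
move=> c0; apply: (@isO_tail _ _ _ _ (fun n _ => c n)) wave_dom_th _ _.
- by move=> n; exact: isO_cst.
- by move=> n z /c0.
Qed.

Local Notation N := (2 * p + 4)%N.

Lemma cos_series_end0 M j :
  Otheta M (fun z => cosn j (- (z.1 / 2)) - (cos_series M j z.1).[0]).
Proof.
exists 1 => // z /wave_dom_th /andP[t0 t1]; rewrite mul1r.
rewrite -mulrN -[- 2^-1]add0r (le_trans (cos_series_bound _ _ _ _)) //.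
by rewrite lerXn2r ?nnegrE // add0r mulrN normrN ger0_norm; lra.
Qed.

Lemma cos_series_end1 M j :
  Otheta M (fun z => cosn j (z.1 / 2) - (cos_series M j z.1).[1]).
Proof.
exists 1 => // z /wave_dom_th /andP[t0 t1]; rewrite mul1r.
have -> : z.1 / 2 = z.1 * (1 - 2^-1) by lra.
rewrite (le_trans (cos_series_bound _ _ _ _)) //.
by rewrite lerXn2r ?nnegrE // ger0_norm; lra.
Qed.

Lemma cosn_OthetaX j : OthetaX 0 (fun z => cosn j (z.1.1 * (z.2 - 2^-1))).
Proof. by exists 1 => // z _; rewrite expr0 mulr1 cosn_le1. Qed.

Lemma Opoly_lin_interp n f g : Otheta n f -> Otheta n g ->
  Opoly n (fun z => lin_interp (f z) (g z)).
Proof.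
move=> Hf Hg; apply: Opoly_add; first exact: Opoly_C.
by have := Opoly_scale (isO_sub Hg Hf) (Opoly_cst 'X); rewrite addn0.
Qed.

Lemma quasi_cos_fix j : Opoly N (fun z => quasi_cos p j z.1 - cos_series N j z.1).
Proof.
apply: Opoly_eq (Opoly_lin_interp (cos_series_end0 N j) (cos_series_end1 N j)) => z.
by rewrite /quasi_cos addrAC subrr add0r.
Qed.

Lemma quasi_cos_approx j :
  OthetaX N (fun z => (quasi_cos p j z.1.1).[z.2] - cosn j (z.1.1 * (z.2 - 2^-1))).
Proof.
have H : OthetaX N (fun z => (cos_series N j z.1.1).[z.2] - cosn j (z.1.1 * (z.2 - 2^-1))).
  exists 1 => // z [/wave_dom_th /andP[t0 t1] /andP[x0 x1]]; rewrite mul1r distrC.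
  rewrite (le_trans (cos_series_bound _ _ _ _)) // lerXn2r ?nnegrE //.
  rewrite normrM ger0_norm // ler_piMr // ler_norml; lra.
apply: isO_eq (isO_add (quasi_cos_fix j) H) _ => z _.
by rewrite hornerD hornerN; ring.
Qed.

Lemma quasi_cos_bounded j : Opoly 0 (fun z => quasi_cos p j z.1).
Proof.
apply: isO_eq (isO_add (OthetaX_weaken (leq0n _) (quasi_cos_approx j)) (cosn_OthetaX j)) _.
by move=> z _; rewrite subrK.
Qed.

Lemma quasi_cos_sqr j :
  Opoly N (fun z => quasi_cos p j z.1 ^+ 2 + quasi_cos p j.+1 z.1 ^+ 2 - 1).
Proof.
have H i := OthetaX_mul (quasi_cos_approx i)
  (isO_add (quasi_cos_bounded i) (cosn_OthetaX i)).
rewrite -[N]addn0; apply: isO_eq (isO_add (H j) (H j.+1)) _ => z _.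
have := cosn_sqr j (z.1.1 * (z.2 - 2^-1)).
set c := cosn j _; set c' := cosn j.+1 _ => E.
rewrite !(hornerE, horner_exp) /= -[X in _ - X]E.
by ring.
Qed.

Lemma cos_series_ode M j z :
  (cos_series M.+2 j z)^`()^`() + z ^+ 2 *: cos_series M.+2 j z =
  z ^+ M.+2 *: (cosn (M + j) 0 *: taylor_mon R M + (z * cosn (M.+1 + j) 0) *: taylor_mon R M.+1).
Proof.
rewrite cos_series_deriv derivZ cos_series_deriv scalerA -expr2 -scalerDr.
rewrite /cos_series !big_ord_recr /= addrA addrA -big_split /= big1 ?add0r.
  rewrite scalerDr scalerDr !scalerA !exprS expr0; move: (z ^+ M) => zM.
  by congr (_ *: _ + _ *: _); ring.
by move=> i _; rewrite !addnS cosnSS scaleNr scalerN addNr.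
Qed.

(** Up to truncation the substitute still solves [e'' + th^2 e = 0]. *)
Lemma quasi_cos_ode j :
  Opoly N (fun z => (quasi_cos p j z.1)^`()^`() + z.1 ^+ 2 *: quasi_cos p j z.1).
Proof.
set M := (2 * p + 2)%N; have NE : N = M.+2 by rewrite /M !addnS addn0.
have H1 : Opoly M.+2 (fun z => z.1 ^+ M.+2 *:
   (cosn (M + j) 0 *: taylor_mon R M + (z.1 * cosn (M.+1 + j) 0) *: taylor_mon R M.+1)).
  rewrite -[X in Opoly X]addn0; apply: Opoly_scale; first exact: Otheta_exp.
  apply: Opoly_add; first exact: Opoly_cst.
  apply: (@Opoly_weaken _ 1) => //.
  have := Opoly_scale (Otheta_mul (Otheta_exp 1) (Otheta_cst (cosn (M.+1 + j) 0))) (Opoly_cst (taylor_mon R M.+1)).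
  by rewrite !addn0.
have H2 := Opoly_scale (Otheta_exp 2) (quasi_cos_fix j).
rewrite NE; apply: Opoly_eq (Opoly_add H1 (Opoly_weaken _ H2)) => [z|]; last by rewrite /M; lia.
have E : (quasi_cos p j z.1)^`()^`() = (cos_series N j z.1)^`()^`().
  by rewrite /quasi_cos derivD deriv_lin_interp derivD derivC addr0.
by rewrite -cos_series_ode -NE E scalerBr -addrA [_ *: cos_series _ _ _ + _]addrC subrK.
Qed.

End Estimates.

Section TrialSize.
Variables (R : realType) (p : nat).
Hypothesis p0 : (0 < p)%N.
Implicit Types (f g : R * R -> R) (F G : R * R -> {poly R}) (j n m : nat).
Local Notation N := (2 * p + 4)%N.

Lemma quasi_cos0 j (th : R) : (quasi_cos p j th).[0] = cosn j (- (th / 2)).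
Proof. by rewrite /quasi_cos hornerD lin_interp0 addrC subrK. Qed.

Lemma quasi_cos1 j (th : R) : (quasi_cos p j th).[1] = cosn j (th / 2).
Proof. by rewrite /quasi_cos hornerD lin_interp1 addrC subrK. Qed.

Lemma quasi_cos_slope j : 
  Otheta N (fun z : R * R => (quasi_cos p j z.1)^`().[0] - z.1 * cosn j.+1 (- (z.1 / 2)))
  /\ Otheta N (fun z : R * R => (quasi_cos p j z.1)^`().[1] - z.1 * cosn j.+1 (z.1 / 2)).
Proof.
have NE : N = (2 * p + 3).+1 by rewrite addnS.
set M := (2 * p + 3)%N in NE.
have H0 := cos_series_end0 R N j; have H1 := cos_series_end1 R N j.
have H := isO_sub H1 H0.
have E (z : R * R) x : (quasi_cos p j z.1)^`().[x] = z.1 * (cos_series M j.+1 z.1).[x] +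
    ((cosn j (z.1 / 2) - (cos_series N j z.1).[1])
     - (cosn j (- (z.1 / 2)) - (cos_series N j z.1).[0])).
  by rewrite /quasi_cos derivD deriv_lin_interp hornerD hornerC {1}NE
    cos_series_deriv hornerZ.
have X1 := @Otheta_exp R 1.
have Y0 := Otheta_mul X1 (cos_series_end0 R M j.+1); rewrite add1n -NE in Y0.
have Y1 := Otheta_mul X1 (cos_series_end1 R M j.+1); rewrite add1n -NE in Y1.
split.
  by apply: isO_eq (isO_sub H Y0) _ => z _; rewrite E expr1; ring.
by apply: isO_eq (isO_sub H Y1) _ => z _; rewrite E expr1; ring.
Qed.

Lemma cosn_OthetaN j : Otheta 0 (fun z : R * R => cosn j (- (z.1 / 2))).
Proof. by exists 1 => // z _; rewrite expr0 mulr1 cosn_le1. Qed.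
Lemma cosn_OthetaP j : Otheta 0 (fun z : R * R => cosn j (z.1 / 2)).
Proof. by exists 1 => // z _; rewrite expr0 mulr1 cosn_le1. Qed.

Definition bdry_flux (u : {poly R}) := u^`().[1] * u.[1] - u^`().[0] * u.[0].

(** For the exact wave the boundary terms of the two components cancel, since
    [cosn j.+2 = - cosn j]. *)
Lemma quasi_cos_flux j : Otheta N (fun z : R * R =>
  bdry_flux (quasi_cos p j z.1) + bdry_flux (quasi_cos p j.+1 z.1)).
Proof.
have [A0 A1] := quasi_cos_slope j; have [B0 B1] := quasi_cos_slope j.+1.
have AP := Otheta_mul A1 (cosn_OthetaP j); have AN := Otheta_mul A0 (cosn_OthetaN j).
have BP := Otheta_mul B1 (cosn_OthetaP j.+1); have BN := Otheta_mul B0 (cosn_OthetaN j.+1).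
rewrite addn0 in AP AN BP BN.
apply: isO_eq (isO_add (isO_sub AP AN) (isO_sub BP BN)) _ => z _.
by rewrite /bdry_flux !quasi_cos0 !quasi_cos1 !cosnSS; ring.
Qed.

Lemma corrector_small n : (n <= p)%N -> corrector R p n = 0.
Proof. by rewrite /corrector => ->. Qed.

Lemma corrector_bump : corrector R p p.+1 = bump R p.
Proof. by rewrite /corrector ltnn eqxx. Qed.

Lemma cosn_zero n : odd n -> cosn n 0 = 0 :> R.
Proof. by move=> on; rewrite -(odd_double_half n) on add1n cosn_odd. Qed.

Local Notation kap := (cosn p.+1.*2 0 : R).

Let rest j n : {poly R} :=
  if n == p.+1 then 0 else cosn (n + j) 0 *: corrector R p n.

(** The term of order [p + 1] is the multiple of [bump]; the term of order [p + 2]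
    drops out because [cosn] of odd index vanishes at [0]. *)
Lemma corrector_series_even :
  exists2 Z : R * R -> {poly R},
    Opoly p.+3 Z /\ Opoly p.+3 (fun z => (Z z)^`())
  & forall z, corrector_series p N p.+1 z.1 = (kap * z.1 ^+ p.+1) *: bump R p + Z z.
Proof.
have r0 n : (n < p.+3)%N -> rest p.+1 n = 0.
  rewrite /rest ltnS; case: eqP => // np1 np2.
  have [->|np] : n = p.+2 \/ (n <= p)%N by lia.
    by rewrite cosn_zero ?scale0r // oddD /=; case: (odd p).
  by rewrite corrector_small // scaler0.
exists (fun z => \sum_(n < N) z.1 ^+ n *: rest p.+1 n) => [|z].
  split; first exact: Opoly_series.
  apply: Opoly_eq (@Opoly_series R N p.+3 (fun n => (rest p.+1 n)^`()) _) => [z|n /r0 ->].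
    by rewrite linear_sum; apply: eq_bigr => i _; rewrite /= derivZ.
  by rewrite deriv0.
have pN : (p.+1 < N)%N by lia.
rewrite /corrector_series (bigD1 (Ordinal pN)) //= corrector_bump addnn scalerA mulrC.
congr (_ + _); rewrite [RHS](bigD1 (Ordinal pN)) //= {1}/rest eqxx scaler0 add0r.
apply: eq_bigr => i /eqP ip; rewrite /rest ifN //; apply/eqP => E.
by apply: ip; apply: val_inj.
Qed.

(** Here the coefficient of order [p + 1] vanishes, again by parity. *)
Lemma corrector_series_odd :
  Opoly p.+2 (fun z : R * R => corrector_series p N p.+2 z.1) /\
  Opoly p.+2 (fun z : R * R => (corrector_series p N p.+2 z.1)^`()).
Proof.
have r0 n : (n < p.+2)%N -> cosn (n + p.+2) 0 *: corrector R p n = 0.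
  move=> np1; have [->|np] : n = p.+1 \/ (n <= p)%N by lia.
    by rewrite cosn_zero ?scale0r // oddD /=; case: (odd p).
  by rewrite corrector_small // scaler0.
split; first exact: (Opoly_series N r0).
apply: Opoly_eq (@Opoly_series R N p.+2 (fun n => (cosn (n + p.+2) 0 *: corrector R p n)^`()) _).
  by move=> z; rewrite linear_sum; apply: eq_bigr => i _; rewrite /= [RHS]derivZ.
by move=> n /r0 ->; rewrite deriv0.
Qed.

Lemma top_taylor_mon n : (n <= p)%N -> top_coef p (taylor_mon R n) = (n == p)%:R.
Proof.
move=> np; rewrite /top_coef; have [->|np'] := eqVneq n p.
  by have := taylor_mon_derivn R p 0; rewrite addn0 => ->; rewrite taylor_mon0 -polyC1 hornerC.
rewrite derivn_poly0 ?horner0 // (leq_trans (size_taylor_mon _ _)) //.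
by rewrite ltn_neqAle np'.
Qed.

Lemma top_fix j : Otheta N (fun z : R * R =>
  top_coef p (quasi_cos p j z.1 - cos_series N j z.1)).
Proof.
have H0 := cos_series_end0 R N j; have H1 := cos_series_end1 R N j.
have Cp := Otheta_mul (isO_sub H1 H0) (Otheta_cst (top_coef p 'X)).
rewrite addn0 in Cp; apply: isO_eq Cp _ => z _.
rewrite /quasi_cos addrAC subrr add0r linearD /= [top_coef p (_ *: 'X)]linearZ /=.
by rewrite {1}/top_coef derivnC gtn_eqF // horner0 add0r.
Qed.

Lemma trial_top_series j (z : R * R) : top_coef p (trial p j z.1) =
  \sum_(n < N) z.1 ^+ n * (cosn (n + j) 0 * top_coef p (taylor_mon R n - corrector R p n))
  + top_coef p (quasi_cos p j z.1 - cos_series N j z.1).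
Proof.
rewrite -[trial p j z.1](_ : \sum_(n < N) z.1 ^+ n *: (cosn (n + j) 0 *: (taylor_mon R n - corrector R p n)) +
   (quasi_cos p j z.1 - cos_series N j z.1) = _).
  rewrite linearD linear_sum /=; congr (_ + _); apply: eq_bigr => n _.
  by rewrite !linearZ.
under eq_bigr do rewrite scalerBr scalerBr.
by rewrite sumrB /trial addrAC addrCA subrr addr0.
Qed.

(** The only term of lower order is the one of degree [p], whose coefficient
    vanishes by parity. *)
Lemma trial_top_even : Otheta p.+1 (fun z : R * R => top_coef p (trial p p.+1 z.1)).
Proof.
have H := Otheta_weaken (_ : p.+1 <= N)%N (top_fix p.+1).
apply: isO_eq (isO_add (@Otheta_series R N p.+1
  (fun n => cosn (n + p.+1) 0 * top_coef p (taylor_mon R n - corrector R p n)) _)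
  (H _)) _ => [n|//|z _]; [|lia|exact: trial_top_series].
rewrite ltnS => np; rewrite corrector_small // subr0 top_taylor_mon //.
have [->|_] := eqVneq n p; last by rewrite mulr0.
by rewrite cosn_zero ?mul0r // oddD /=; case: (odd p).
Qed.

(** In this component the term of degree [p] survives and carries the whole
    leading part of the penalty. *)
Lemma trial_top_odd :
  Otheta p.+2 (fun z : R * R => top_coef p (trial p p.+2 z.1) - kap * z.1 ^+ p).
Proof.
pose c n := if n == p then 0
   else cosn (n + p.+2) 0 * top_coef p (taylor_mon R n - corrector R p n) : R.
have pN : (p < N)%N by lia.
have H := Otheta_weaken (_ : p.+2 <= N)%N (top_fix p.+2).
apply: isO_eq (isO_add (@Otheta_series R N p.+2 c _) (H _)) _ => [n||z _]; last first.
- rewrite trial_top_series (bigD1 (Ordinal pN)) //= [in RHS](bigD1 (Ordinal pN)) //=.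
  rewrite /c eqxx mulr0 add0r corrector_small // subr0 top_taylor_mon // eqxx mulr1.
  rewrite !addnS addnn [z.1 ^+ p * _]mulrC.
  have -> : \sum_(i < N | i != Ordinal pN) z.1 ^+ i * (if i == p :> nat then 0
     else cosn (i + p.+2) 0 * top_coef p (taylor_mon R i - corrector R p i)) =
    \sum_(i < N | i != Ordinal pN)
     z.1 ^+ i * (cosn (i + p.+2) 0 * top_coef p (taylor_mon R i - corrector R p i)).
    by apply: eq_bigr => i ip; rewrite ifN.
  by rewrite -doubleS; ring.
- by lia.
rewrite /c => np; case: eqP => // /eqP npp.
have [->|np'] : n = p.+1 \/ (n < p)%N by lia.
  by rewrite cosn_zero ?mul0r // oddD /=; case: (odd p).
by rewrite corrector_small ?(ltnW np') // subr0 top_taylor_mon ?(ltnW np') // ltn_eqF // mulr0.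
Qed.

End TrialSize.

(** * Residual and energy of the trial wave *)

Section Energy.
Variables (R : realType) (p : nat) (gamma : R).
Hypothesis p0 : (0 < p)%N.
Implicit Types (f g : R * R -> R) (F G : R * R -> {poly R}) (j n m : nat) (z : R * R).
Local Notation N := (2 * p + 4)%N.
Local Notation kap := (cosn p.+1.*2 0 : R).

(** A jump of a Bloch wave contributes the factor [|1 - e^{i th}|^2]. *)
Definition penalty (th : R) : R := gamma * (2 - 2 * cos th).
Definition delta z : R := z.1 ^+ 2 - z.2 ^+ 2.
(** The error allowed in the dispersion function.  The second summand is harmless
    since [th^2 - t^2] is itself of order [2 p + 2] at the root. *)
Definition gauge z : R := z.1 ^+ N + `|delta z| * z.1 ^+ 2.
Definition Ogauge f := isO (@wave_dom R) gauge f.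

Lemma Ogauge_Otheta n f : (N <= n)%N -> Otheta n f -> Ogauge f.
Proof.
move=> Nn /(Otheta_weaken Nn); apply: isO_le => z _.
by rewrite lerDl mulr_ge0 ?sqr_ge0.
Qed.

Lemma Ogauge_delta f : Otheta 2 f -> Ogauge (fun z => delta z * f z).
Proof.
move=> [C C0 H]; exists C => // z Dz; rewrite normrM.
have /andP[z0 _] := wave_dom_th Dz.
rewrite (le_trans (ler_wpM2l _ (H z Dz))) // mulrCA ler_wpM2l // lerDr.
exact: exprn_ge0.
Qed.

Lemma Otheta_delta : Otheta 2 delta.
Proof.
have Ht := Otheta_mul (@Otheta_t R) (@Otheta_t R).
by apply: isO_eq (isO_sub (@Otheta_exp R 2) Ht) _ => z _; rewrite /delta -expr2.
Qed.

Lemma cos_quadratic : Otheta 4 (fun z => 2 - 2 * cos z.1 - z.1 ^+ 2).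
Proof.
exists 2 => // z /wave_dom_th /andP[z0 _].
have := @cos_taylor_bound R 0 4 z.1.
rewrite cosn0 (ger0_norm z0) horner_poly !big_ord_recr big_ord0 /= !addn0.
rewrite !cosnSS cosnS cosn0 cos0 mul0r addr0 sin0 !oppr0 !mul0r !addr0 add0r.
rewrite expr0 mulr1 fact0 divr1 (_ : 2`! = 2)%N // !ler_norml => /andP[H1 H2].
by apply/andP; split; lra.
Qed.

Lemma penalty_quadratic : Otheta 4 (fun z => penalty z.1 - gamma * z.1 ^+ 2).
Proof.
by apply: isO_eq (isO_scale gamma cos_quadratic) _ => z _; rewrite /penalty; ring.
Qed.

Lemma Otheta_penalty : Otheta 2 (fun z => penalty z.1).
Proof.
have H := isO_scale gamma (@Otheta_exp R 2).
apply: isO_eq (isO_add (@Otheta_weaken R 2 4 _ isT penalty_quadratic) H) _ => z _.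
by rewrite subrK.
Qed.

Lemma sqr_sum5 (a b c d e : R) : (a + b + c + d + e) ^+ 2 <=
  5 * (a ^+ 2 + b ^+ 2 + c ^+ 2 + d ^+ 2 + e ^+ 2).
Proof.
rewrite -subr_ge0 (_ : _ - _ = (a - b) ^+ 2 + (a - c) ^+ 2 + (a - d) ^+ 2
  + (a - e) ^+ 2 + (b - c) ^+ 2 + (b - d) ^+ 2 + (b - e) ^+ 2 + (c - d) ^+ 2
  + (c - e) ^+ 2 + (d - e) ^+ 2); last by ring.
by rewrite !addr_ge0 ?sqr_ge0.
Qed.

Lemma Opoly_sqr n F : Opoly n F -> Opoly (n + n) (fun z => F z ^+ 2).
Proof. by move=> H; apply: Opoly_eq (Opoly_mul H H) => z; rewrite expr2. Qed.

(** The summand [c z *: bump] of the correction is orthogonal to the derivatives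
    of bubbles, so only the smaller part [Z] of the correction enters the residual. *)
Lemma trial_residual j (c : R * R -> R) (Z : R * R -> {poly R}) :
  Opoly p.+2 (fun z => (Z z)^`()) -> Opoly p.+1 (fun z => corrector_series p N j z.1) ->
  (forall z, corrector_series p N j z.1 = c z *: bump R p + Z z) ->
  Otheta p (fun z => top_coef p (trial p j z.1)) ->
  exists2 rho, Ogauge rho & forall z b, bubble p b ->
    ref_form p z.2 (penalty z.1) (trial p j z.1) b ^+ 2 <= rho z * poly_int (b^`() ^+ 2).
Proof.
move=> HZ Hc Ec Ht; have [K K0 HK] := top_coef_bound R p0.
pose e z := quasi_cos p j z.1; pose q z := (e z)^`()^`() + z.1 ^+ 2 *: e z.
pose eta z := corrector_series p N j z.1; pose w z := trial p j z.1.
exists (fun z => 5 * (poly_int (q z ^+ 2) + delta z ^+ 2 * poly_int (e z ^+ 2)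
   + poly_int ((Z z)^`() ^+ 2) + z.2 ^+ 4 * poly_int (eta z ^+ 2)
   + K * (penalty z.1 * top_coef p (w z)) ^+ 2)).
  apply: isO_scale; apply: isO_add; [apply: isO_add; [apply: isO_add;
    [apply: isO_add|]|]|].
  - apply: Ogauge_Otheta _ (Opoly_int (Opoly_sqr (quasi_cos_ode R p j))); lia.
  - have H := Ogauge_delta (Otheta_mul Otheta_delta (Opoly_int (Opoly_sqr (quasi_cos_bounded R p j)))).
    by apply: isO_eq H _ => z _; rewrite /= mulrA -expr2.
  - apply: Ogauge_Otheta _ (Opoly_int (Opoly_sqr HZ)); lia.
  - have H2 := Otheta_mul (@Otheta_t R) (@Otheta_t R).
    have H4 := Otheta_mul (Otheta_mul H2 H2) (Opoly_int (Opoly_sqr Hc)).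
    by apply: isO_eq (Ogauge_Otheta _ H4) _ => [|z _]; [lia|rewrite -!expr2 -exprM].
  - have H2 := Otheta_mul Otheta_penalty Ht.
    by apply: isO_scale; apply: isO_eq (Ogauge_Otheta _ (Otheta_mul H2 H2)) _ => [|z _]; [lia|rewrite -expr2].
move=> z b bb; have [sb b0 b1] := bb; set nb := poly_int (b^`() ^+ 2).
have nb0 : 0 <= nb by exact: poly_int_sqr_ge0.
have nbb : poly_int (b ^+ 2) <= nb by exact: poincare.
have sb' : (size b^`() <= p)%N by rewrite -derivn1 size_derivn_leq // add1n.
have Ee : poly_int ((e z)^`() * b^`()) = - poly_int (q z * b)
     + z.1 ^+ 2 * poly_int (e z * b).
  have := poly_int_parts b (e z)^`().
  rewrite b0 b1 !mul0r subrr sub0r mulrC => ->.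
  by rewrite /q mulrDl poly_intD -scalerAl poly_intZ [b * _]mulrC opprD subrK.
have E : ref_form p z.2 (penalty z.1) (w z) b =
    - poly_int (q z * b) + delta z * poly_int (e z * b) - poly_int ((Z z)^`() * b^`())
    + z.2 ^+ 2 * poly_int (eta z * b) + (penalty z.1 * top_coef p (w z)) * top_coef p b.
  have -> : ref_form p z.2 (penalty z.1) (w z) b = poly_int ((e z)^`() * b^`())
    - poly_int ((eta z)^`() * b^`()) - z.2 ^+ 2 * (poly_int (e z * b) - poly_int (eta z * b))
    + penalty z.1 * (top_coef p (w z) * top_coef p b).
    by rewrite /ref_form -!poly_intB -!mulrBl -derivB.
  have -> : poly_int ((eta z)^`() * b^`()) = poly_int ((Z z)^`() * b^`()).
    rewrite /eta Ec derivD derivZ mulrDl -scalerAl poly_intD poly_intZ.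
    by rewrite bump_orth // mulr0 add0r.
  by rewrite Ee /delta; ring.
rewrite -/(w z) E; apply: le_trans (sqr_sum5 _ _ _ _ _) _; rewrite -[leRHS]mulrA ler_wpM2l //.
have CS u v : poly_int (v ^+ 2) <= nb -> poly_int (u * v) ^+ 2 <= poly_int (u ^+ 2) * nb.
  move=> H; apply: le_trans (poly_int_CS _ _) _.
  by rewrite ler_wpM2l // poly_int_sqr_ge0.
have dist A B C D E' : (A + B + C + D + E') * nb = A * nb + B * nb + C * nb + D * nb + E' * nb.
  by ring.
rewrite dist [(- poly_int (q z * b)) ^+ 2]sqrrN [(- poly_int _) ^+ 2]sqrrN.
apply: lerD; [apply: lerD; [apply: lerD; [apply: lerD|]|]|].
- exact: CS.
- by rewrite exprMn -[leRHS]mulrA ler_wpM2l ?sqr_ge0 // CS.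
- exact: (CS _ _ (lexx _)).
- by rewrite exprMn -exprM -[leRHS]mulrA ler_wpM2l ?CS // (exprM _ 2 2) sqr_ge0.
- rewrite [leLHS]exprMn [K * _]mulrC -[leRHS]mulrA ler_wpM2l ?sqr_ge0 //; exact: HK.
Qed.

(** Integrate by parts in the terms that contain [e]; what is left of [e] is its
    defect [q] in the differential equation and the factor [th^2 - t^2]. *)
Lemma energy_expand (e eta : {poly R}) (th t mu : R) :
  eta.[0] = 0 -> eta.[1] = 0 ->
  let q := e^`()^`() + th ^+ 2 *: e in
  ref_form p t mu (e - eta) (e - eta) =
    bdry_flux e - poly_int (q * e) + 2 * poly_int (q * eta)
    + (th ^+ 2 - t ^+ 2) * (poly_int (e ^+ 2) - 2 * poly_int (e * eta))
    + poly_int (eta^`() ^+ 2) - t ^+ 2 * poly_int (eta ^+ 2)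
    + mu * top_coef p (e - eta) ^+ 2.
Proof.
move=> h0 h1 q.
have P1 : poly_int (e^`() ^+ 2) = bdry_flux e - poly_int (q * e)
    + th ^+ 2 * poly_int (e ^+ 2).
  have := poly_int_parts e e^`().
  rewrite /q mulrDl poly_intD -scalerAl poly_intZ /bdry_flux [e^`() ^+ 2]expr2 => ->.
  by rewrite [e * _^`()]mulrC -expr2; ring.
have P2 : poly_int (e^`() * eta^`()) = - poly_int (q * eta) + th ^+ 2 * poly_int (e * eta).
  have := poly_int_parts eta e^`().
  rewrite h0 h1 !mul0r subrr sub0r mulrC => ->.
  rewrite /q mulrDl poly_intD -scalerAl poly_intZ [eta * _^`()]mulrC; ring.
have sq (u v : {poly R}) : (u - v) * (u - v) = u ^+ 2 - 2 *: (u * v) + v ^+ 2.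
  by rewrite -mul_polyC; ring.
rewrite /ref_form derivB !sq !(poly_intB, poly_intD, poly_intZ) -!expr2.
by rewrite P1 P2; ring.
Qed.

End Energy.

(** * Discretely harmonic polynomials *)

Section Harmonic.
Variables (R : realType) (p : nat).
Hypothesis p0 : (0 < p)%N.
Implicit Types (u v w b g : {poly R}) (t mu rho : R).

Definition harmonic t mu u := forall b, bubble p b -> ref_form p t mu u b = 0.

Definition coercive t mu := forall b, bubble p b ->
  poly_int (b^`() ^+ 2) <= 2 * ref_form p t mu b b.

(** The Poincare inequality absorbs the term with [t], and [top_coef_bound]
    absorbs a penalty of either sign. *)
Lemma small_coercive : exists2 K : R, 0 < K & forall t mu, t ^+ 2 <= 4^-1 ->
  `|mu| * K <= 4^-1 -> coercive t mu.
Proof.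
have [K K0 HK] := top_coef_bound R p0; exists K => // t mu t4 muK b bb.
have [sb b0 b1] := bb; rewrite /ref_form -!expr2.
set nb := poly_int (b^`() ^+ 2); set tb := top_coef p b.
have P : poly_int (b ^+ 2) <= nb by exact: poincare.
have P0 : 0 <= poly_int (b ^+ 2) by exact: poly_int_sqr_ge0.
have nb0 : 0 <= nb by exact: poly_int_sqr_ge0.
have H1 : t ^+ 2 * poly_int (b ^+ 2) <= 4^-1 * nb.
  by apply: ler_pM => //; exact: sqr_ge0.
have H2 : `|mu * tb ^+ 2| <= 4^-1 * nb.
  rewrite normrM (ger0_norm (sqr_ge0 tb)).
  apply: le_trans (ler_wpM2l (normr_ge0 mu) (HK b sb)) _.
  by rewrite mulrA ler_wpM2r.
by move: H2; rewrite ler_norml => /andP[H2 _]; lra.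
Qed.

Lemma coercive_def t mu : coercive t mu ->
  forall b, bubble p b -> ref_form p t mu b b = 0 -> b = 0.
Proof.
move=> co b bb E; apply: (bubble_deriv_eq0 bb); apply/eqP.
by rewrite eq_le poly_int_sqr_ge0 andbT; have := co b bb; rewrite E mulr0.
Qed.

(** With [d = w - u] the energies differ by the form at [d], which equals the
    residual of [w] at [d]; coercivity turns this into the square of the residual. *)
Lemma harmonic_gap t mu rho u w :
  (size u <= p.+1)%N -> (size w <= p.+1)%N -> u.[0] = w.[0] -> u.[1] = w.[1] ->
  harmonic t mu u -> coercive t mu -> 0 <= rho ->
  (forall b, bubble p b ->
    ref_form p t mu w b ^+ 2 <= rho * poly_int (b^`() ^+ 2)) ->
  `|ref_form p t mu u u - ref_form p t mu w w| <= 2 * rho.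
Proof.
move=> su sw e0 e1 hu co rho0 res.
have [d wE bd] : exists2 d, w = u + d & bubble p d.
  exists (w - u); first by rewrite addrC subrK.
  split; rewrite ?hornerD ?hornerN ?e0 ?e1 ?subrr //.
  by rewrite (leq_trans (size_polyD _ _)) // geq_max size_polyN su sw.
set Q := ref_form p t mu d d.
have E : ref_form p t mu w w = ref_form p t mu u u + Q.
  rewrite wE !linearD /= !ref_formDl (ref_formC _ _ _ d u) (hu d bd).
  by rewrite addr0 add0r.
have E2 : ref_form p t mu w d = Q by rewrite wE ref_formDl (hu d bd) add0r.
have Q0 : 0 <= Q.
  by have := co d bd; have := poly_int_sqr_ge0 d^`(); rewrite -/Q; lra.
have := res d bd; rewrite E2 => H.
rewrite E opprD addNKr normrN ger0_norm //.
have [->|Qn0] := eqVneq Q 0; first by rewrite mulr_ge0.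
have Qp : 0 < Q by rewrite lt0r Qn0.
rewrite -(ler_pM2r Qp) -expr2 (le_trans H) //.
rewrite [leRHS](_ : _ = rho * (2 * Q)); last by ring.
by rewrite ler_wpM2l // co.
Qed.

Lemma harmonic_ext t (a c : R) : coercive t 0 ->
  exists u, [/\ (size u <= p.+1)%N, u.[0] = a, u.[1] = c & harmonic t 0 u].
Proof.
move=> co; pose l := lin_interp a c.
have [g [sg g0 g1] Hg] := riesz (ref_form p t 0 (- l)) (coercive_def co).
exists (l + g); split; rewrite ?(hornerD l g) ?g0 ?g1 ?addr0 ?lin_interp0 ?lin_interp1 //.
  rewrite (leq_trans (size_polyD _ _)) // geq_max sg andbT.
  by rewrite (leq_trans (size_lin_interp _ _)).
by move=> b bb; rewrite ref_formDl Hg // -ref_formDl subrr ref_formC linear0.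
Qed.

(** Changing the penalty is a rank one perturbation of the form in the direction
    of [top_coef]; the bubble [g] represents that functional. *)
Lemma load_response t : coercive t 0 ->
  exists2 g, bubble p g & forall b, bubble p b -> ref_form p t 0 g b = top_coef p b.
Proof. by move=> co; exact: (riesz (top_coef p) (coercive_def co)). Qed.

Section Penalized.
Variables (t : R) (A0 A1 g : {poly R}).
Hypotheses (h0 : harmonic t 0 A0) (h1 : harmonic t 0 A1) (bg : bubble p g).
Hypothesis hg : forall b, bubble p b -> ref_form p t 0 g b = top_coef p b.

Definition load_coef mu a c : R :=
  - (mu * (a * top_coef p A0 + c * top_coef p A1)) / (1 + mu * top_coef p g).

(** The harmonic polynomial for the penalised form, written through three
    polynomials that do not depend on [mu].  This makes its dependence on [th] an
    explicit and continuous one. *)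
Definition penalized mu a c : {poly R} :=
  a *: A0 + c *: A1 + load_coef mu a c *: g.

Lemma penalized_harmonic mu a c :
  1 + mu * top_coef p g != 0 -> harmonic t mu (penalized mu a c).
Proof.
move=> nz b bb; rewrite ref_form_mu /penalized !ref_formDl !ref_formZl.
rewrite (h0 bb) (h1 bb) (hg bb) !linearD !linearZ /= /load_coef; field.
exact: nz.
Qed.

Lemma penalized_energy mu a c :
  ref_form p t mu (penalized mu a c) (penalized mu a c) =
  a ^+ 2 * ref_form p t 0 A0 A0 + c ^+ 2 * ref_form p t 0 A1 A1
  + 2 * a * c * ref_form p t 0 A0 A1 + load_coef mu a c ^+ 2 * top_coef p g
  + mu * (a * top_coef p A0 + c * top_coef p A1 + load_coef mu a c * top_coef p g) ^+ 2.
Proof.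
rewrite ref_form_mu /penalized; set s := load_coef mu a c.
rewrite !ref_formDl !ref_formZl !linearD !linearZ /= (h0 bg) (h1 bg) (hg bg).
rewrite ![ref_form p t 0 g _]ref_formC (h0 bg) (h1 bg) (ref_formC _ _ _ A1 A0).
by ring.
Qed.

(** If [s] is the value of [top_coef] at [g], coercivity gives [s^2 <= 2 K s]. *)
Lemma load_response_bound (K mu : R) : coercive t 0 -> 0 < K ->
  (forall b, (size b <= p.+1)%N -> top_coef p b ^+ 2 <= K * poly_int (b^`() ^+ 2)) ->
  `|mu| * K <= 4^-1 -> 1 + mu * top_coef p g != 0.
Proof.
move=> co K0 HK muK; have [sg _ _] := bg; set s := top_coef p g.
have H1 : s ^+ 2 <= K * poly_int (g^`() ^+ 2) by exact: HK.
have H2 : poly_int (g^`() ^+ 2) <= 2 * s by rewrite /s -(hg bg); exact: co.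
have H3 : s ^+ 2 <= K * (2 * s) by rewrite (le_trans H1) // ler_wpM2l // ltW.
have s0 : 0 <= s by have := poly_int_sqr_ge0 g^`(); lra.
have s2 : s <= 2 * K.
  have [->|sn0] := eqVneq s 0; first by rewrite mulr_ge0 // ltW.
  have sp : 0 < s by rewrite lt0r sn0.
  by rewrite -(ler_pM2r sp) -expr2 (le_trans H3) // mulrA [K * 2]mulrC.
have : `|mu * s| <= 2^-1.
  rewrite normrM (ger0_norm s0) (le_trans (ler_wpM2l (normr_ge0 mu) s2)) //; lra.
by rewrite ler_norml => /andP[H _]; rewrite gt_eqF //; lra.
Qed.

End Penalized.

End Harmonic.

(** * Asymptotics of the dispersion function *)

Section Dispersion.
Variables (R : realType) (p : nat) (gamma : R).
Hypothesis p0 : (0 < p)%N.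
Implicit Types (u v w b g : {poly R}) (z : R * R).
Local Notation N := (2 * p + 4)%N.
Local Notation kap := (cosn p.+1.*2 0 : R).

Definition phase_coef : R :=
  (2 * p + 1)%:R^-1 * (p`!%:R / (2 * p)`!%:R) ^+ 2 + gamma.

Definition trial_sum z : R :=
  ref_form p z.2 (penalty gamma z.1) (trial p p.+1 z.1) (trial p p.+1 z.1)
  + ref_form p z.2 (penalty gamma z.1) (trial p p.+2 z.1) (trial p p.+2 z.1).

(** The error terms are estimated one by one; the leading terms are the energy of
    the corrector in the first component and the penalty in the second. *)
Lemma trial_energy :
  Ogauge p (fun z => trial_sum z - (delta z + phase_coef * z.1 ^+ (2 * p + 2))).
Proof.
have [Z [OZ OZ'] EZ] := corrector_series_even R p0.
have [OY OY'] := corrector_series_odd R p0.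
pose ea z := quasi_cos p p.+1 z.1; pose eb z := quasi_cos p p.+2 z.1.
pose qa z := (ea z)^`()^`() + z.1 ^+ 2 *: ea z.
pose qb z := (eb z)^`()^`() + z.1 ^+ 2 *: eb z.
pose ha z := corrector_series p N p.+1 z.1; pose hb z := corrector_series p N p.+2 z.1.
pose ta z := top_coef p (trial p p.+1 z.1).
pose r z := top_coef p (trial p p.+2 z.1) - kap * z.1 ^+ p.
have Ota : Otheta p.+1 ta by exact: trial_top_even.
have Or : Otheta p.+2 r by exact: trial_top_odd.
have Oq j : Opoly N (fun z => (quasi_cos p j z.1)^`()^`() + z.1 ^+ 2 *: quasi_cos p j z.1).
  exact: quasi_cos_ode.
have Oe j : Opoly 0 (fun z => quasi_cos p j z.1) by exact: quasi_cos_bounded.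
have Oha : Opoly p.+1 ha.
  have H := Opoly_scale (isO_scale kap (@Otheta_exp R p.+1)) (Opoly_cst (bump R p)).
  rewrite addn0 in H.
  have OZ1 : Opoly p.+1 Z by apply: Opoly_weaken OZ; lia.
  by apply: Opoly_eq (Opoly_add H OZ1) => z; rewrite /ha EZ.
have T1 : Ogauge p (fun z => bdry_flux (ea z) + bdry_flux (eb z)).
  by apply: Ogauge_Otheta _ (quasi_cos_flux R p p.+1).
have T2 : Ogauge p (fun z => poly_int (qa z * ea z) + poly_int (qb z * eb z)).
  by apply: isO_add; apply: Ogauge_Otheta _ (Opoly_int (Opoly_mul (Oq _) (Oe _))); lia.
have T3 : Ogauge p (fun z => 2 * (poly_int (qa z * ha z) + poly_int (qb z * hb z))).
  apply: isO_scale; apply: isO_add.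
    by apply: Ogauge_Otheta _ (Opoly_int (Opoly_mul (Oq _) Oha)); lia.
  by apply: Ogauge_Otheta _ (Opoly_int (Opoly_mul (Oq _) OY)); lia.
have T4 : Ogauge p (fun z => delta z * (poly_int (ea z ^+ 2 + eb z ^+ 2 - 1)
    - 2 * (poly_int (ea z * ha z) + poly_int (eb z * hb z)))).
  apply: Ogauge_delta; apply: isO_sub.
    by apply: Otheta_weaken (Opoly_int (quasi_cos_sqr R p p.+1)); lia.
  apply: isO_scale; apply: isO_add.
    by apply: Otheta_weaken (Opoly_int (Opoly_mul (Oe _) Oha)); lia.
  by apply: Otheta_weaken (Opoly_int (Opoly_mul (Oe _) OY)); lia.
have T5 : Ogauge p (fun z => 2 * (kap * (z.1 ^+ p.+1 * poly_int ((bump R p)^`() * (Z z)^`())))).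
  do 2 apply: isO_scale.
  by apply: Ogauge_Otheta _ (Otheta_mul (@Otheta_exp R _) (Opoly_int (Opoly_mul (Opoly_cst _) OZ'))); lia.
have T6 : Ogauge p (fun z => poly_int ((Z z)^`() ^+ 2) + poly_int ((hb z)^`() ^+ 2)).
  apply: isO_add.
    by apply: Ogauge_Otheta _ (Opoly_int (Opoly_sqr OZ')); lia.
  by apply: Ogauge_Otheta _ (Opoly_int (Opoly_sqr OY')); lia.
have T7 : Ogauge p (fun z => z.2 * z.2 * (poly_int (ha z ^+ 2) + poly_int (hb z ^+ 2))).
  have H : Otheta (p.+1 + p.+1) (fun z => poly_int (ha z ^+ 2) + poly_int (hb z ^+ 2)).
    apply: isO_add; first exact: Opoly_int (Opoly_sqr Oha).
    by apply: Otheta_weaken (Opoly_int (Opoly_sqr OY)); lia.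
  by apply: Ogauge_Otheta _ (Otheta_mul (Otheta_mul (@Otheta_t R) (@Otheta_t R)) H); lia.
have T8 : Ogauge p (fun z => penalty gamma z.1 * (ta z * ta z)).
  by apply: Ogauge_Otheta _ (Otheta_mul (Otheta_penalty gamma) (Otheta_mul Ota Ota)); lia.
have T9 : Ogauge p (fun z => penalty gamma z.1 * (2 * (kap * (z.1 ^+ p * r z)) + r z * r z)).
  have H1 := isO_scale 2 (isO_scale kap (Otheta_mul (@Otheta_exp R p) Or)).
  have H2 : Otheta (p + p.+2) (fun z => r z * r z).
    by apply: Otheta_weaken (Otheta_mul Or Or); lia.
  by apply: Ogauge_Otheta _ (Otheta_mul (Otheta_penalty gamma) (isO_add H1 H2)); lia.
have T10 : Ogauge p (fun z => (penalty gamma z.1 - gamma * z.1 ^+ 2) * z.1 ^+ (2 * p)).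
  by apply: Ogauge_Otheta _ (Otheta_mul (penalty_quadratic gamma) (@Otheta_exp R _)); lia.
have S1 := isO_add (isO_sub T1 T2) T3.
have S2 := isO_add (isO_add S1 T4) (isO_add T5 T6).
have S3 := isO_add (isO_sub S2 T7) (isO_add (isO_add T8 T9) T10).
apply: isO_eq S3 _ => z _.
have [ea0 ea1] := corrector_series_ends p0 N p.+1 z.1.
have [eb0 eb1] := corrector_series_ends p0 N p.+2 z.1.
rewrite /trial_sum /trial (@energy_expand R p _ _ z.1 _ _ ea0 ea1).
rewrite (@energy_expand R p _ _ z.1 _ _ eb0 eb1) -/(ea z) -/(eb z) -/(ha z) -/(hb z).
have Eh : poly_int ((ha z)^`() ^+ 2) = z.1 ^+ (2 * p + 2) * poly_int ((bump R p)^`() ^+ 2)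
   + 2 * (kap * (z.1 ^+ p.+1 * poly_int ((bump R p)^`() * (Z z)^`()))) + poly_int ((Z z)^`() ^+ 2).
  rewrite /ha EZ derivD derivZ sqrrD exprZn exprMn cosn_even_sqr mul1r -exprM.
  rewrite -[_ *+ 2]scaler_nat -scalerAl !poly_intD !poly_intZ.
  rewrite (_ : (p.+1 * 2)%N = (2 * p + 2)%N); last by lia.
 by rewrite -!mulrA.
have Ee : poly_int (ea z ^+ 2 + eb z ^+ 2 - 1) =
    poly_int (ea z ^+ 2) + poly_int (eb z ^+ 2) - 1.
  by rewrite poly_intB poly_intD -polyC1 poly_intC.
have Et : top_coef p (eb z - hb z) = kap * z.1 ^+ p + r z.
  by rewrite /r [RHS]addrC subrK.
have Ek : (kap * z.1 ^+ p) ^+ 2 = z.1 ^+ (2 * p).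
  by rewrite exprMn cosn_even_sqr mul1r -exprM mulnC.
rewrite Eh Et Ee bump_energy // [(kap * _ + r z) ^+ 2]sqrrD Ek /phase_coef -/(qa z) -/(qb z).
rewrite -[top_coef p (ea z - ha z)]/(ta z) exprD /delta -[_ *+ 2]mulr_natr.
by ring.
Qed.

End Dispersion.

(** * The root of the dispersion function *)

Section DispersionFunction.
Local Open Scope classical_set_scope.
Variables (R : realType) (p : nat) (gamma : R).
Hypothesis p0 : (0 < p)%N.
Implicit Types (u v w b g : {poly R}) (t th : R).
Local Notation kappa := (phase_coef p gamma).

Definition wave_component t th j u :=
  [/\ (size u <= p.+1)%N, u.[0] = cosn j (- (th / 2)), u.[1] = cosn j (th / 2)
    & harmonic p t (penalty gamma th) u].

(** The pair [(u, v)] encodes the Bloch wave [u - i v] on one cell, with the phase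
    fixed by [cosn]; the last equation says that its energy vanishes. *)
Definition discrete_mode t th :=
  exists u v, [/\ wave_component t th p.+1 u, wave_component t th p.+2 v &
    ref_form p t (penalty gamma th) u u + ref_form p t (penalty gamma th) v v = 0].

Lemma cosn_continuous j : continuous (@cosn R j).
Proof.
move=> x; apply: differentiable_continuous; apply/derivable1_diffP.
by case: (is_derive_cosn j x).
Qed.

Lemma cosn_half_continuous j (a : R) : continuous (fun th : R => cosn j (a * th)).
Proof.
move=> x; apply: continuous_comp; last exact: cosn_continuous.
exact: mulrl_continuous.
Qed.

Lemma penalty_continuous : continuous (penalty gamma).
Proof.
move=> x; apply: cvgM; first exact: cvg_cst.
apply: cvgB; first exact: cvg_cst.
by apply: cvgM; [exact: cvg_cst | exact: continuous_cos].
Qed.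

Lemma penalty_small (e : R) : 0 < e -> exists2 d : R, 0 < d <= 1 &
  forall th, 0 < th <= d -> `|penalty gamma th| <= e.
Proof.
move=> e0; have [C C0 H] := Otheta_penalty gamma.
have C1 : 0 < C + 1 by rewrite ltr_wpDl.
exists (Num.min 1 (e / (C + 1))).
  by rewrite lt_min ltr01 divr_gt0 //= ge_min lexx.
move=> th; rewrite le_min => /and3P[th0 th1 the].
have Dz : wave_dom (th, th).
  by split; rewrite /= th0 //= ler_peMl ?ltW // ltr1n.
apply: le_trans (H _ Dz) _; rewrite /=.
apply: (@le_trans _ _ ((C + 1) * th)); last by rewrite mulrC -ler_pdivlMr.
rewrite ler_pM ?exprn_ge0 ?(ltW th0) ?lerDl // expr2.
by rewrite ler_piMl // ltW.
Qed.

(** A common bound for the residuals of both components. *)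
Lemma trial_residuals : exists2 rho : R * R -> R, Ogauge p rho &
  forall z, wave_dom z -> 0 <= rho z /\ forall j b, j = p.+1 \/ j = p.+2 -> bubble p b ->
    ref_form p z.2 (penalty gamma z.1) (trial p j z.1) b ^+ 2
      <= rho z * poly_int (b^`() ^+ 2).
Proof.
have [Z [OZ OZ'] EZ] := corrector_series_even R p0.
have [OY OY'] := corrector_series_odd R p0.
pose kap : R := cosn p.+1.*2 0.
have [ra Oa Ha] : exists2 rho, Ogauge p rho & forall z b, bubble p b ->
    ref_form p z.2 (penalty gamma z.1) (trial p p.+1 z.1) b ^+ 2
      <= rho z * poly_int (b^`() ^+ 2).
  apply: (@trial_residual R p gamma p0 p.+1 (fun z => kap * z.1 ^+ p.+1) Z) => //.
  - by apply: Opoly_weaken OZ'; lia.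
  - have H := Opoly_scale (isO_scale kap (@Otheta_exp R p.+1)) (Opoly_cst (bump R p)).
    rewrite addn0 in H.
    have OZ1 : Opoly p.+1 Z by apply: Opoly_weaken OZ; lia.
    by apply: Opoly_eq (Opoly_add H OZ1) => z; rewrite EZ.
  - by apply: Otheta_weaken (trial_top_even R p0).
have [rb Ob Hb] : exists2 rho, Ogauge p rho & forall z b, bubble p b ->
    ref_form p z.2 (penalty gamma z.1) (trial p p.+2 z.1) b ^+ 2
      <= rho z * poly_int (b^`() ^+ 2).
  apply: (@trial_residual R p gamma p0 p.+2 (fun=> 0)
    (fun z => corrector_series p (2 * p + 4) p.+2 z.1)) => //.
  - by apply: Opoly_weaken OY; lia.
  - by move=> z; rewrite scale0r add0r.
  - have H : Otheta p (fun z => top_coef p (trial p p.+2 z.1) - kap * z.1 ^+ p).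
      by apply: Otheta_weaken (trial_top_odd R p0); lia.
    apply: isO_eq (isO_add H (isO_scale kap (@Otheta_exp R p))) _ => z _.
    by rewrite subrK.
exists (fun z => `|ra z| + `|rb z|).
  by apply: isO_add; [case: Oa|case: Ob] => C C0 H; exists C => // z Dz;
    rewrite normr_id H.
move=> z _; split; first by rewrite addr_ge0.
move=> j b [->|->] bb; rewrite mulrDl.
  apply: le_trans (Ha z b bb) _; rewrite -[leLHS]addr0 lerD //.
    by rewrite ler_wpM2r ?poly_int_sqr_ge0 ?ler_norm.
  by rewrite mulr_ge0 ?poly_int_sqr_ge0.
apply: le_trans (Hb z b bb) _; rewrite -[leLHS]add0r lerD //.
  by rewrite mulr_ge0 ?poly_int_sqr_ge0.
by rewrite ler_wpM2r ?poly_int_sqr_ge0 ?ler_norm.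
Qed.

(** The dispersion function is the energy of the pair of harmonic polynomials with
    the end values of the exact wave. *)
Lemma mode_function : exists d K : R, [/\ 0 < d <= 4^-1, 0 <= K &
  forall t, 0 < t <= d -> exists S : R -> R,
  [/\ forall th, 0 < th <= 2 * d -> {for th, continuous S},
      forall th, th <= 2 * d -> wave_dom (th, t) ->
        `|S th - (delta (th, t) + kappa * th ^+ (2 * p + 2))| <= K * gauge p (th, t)
    & forall th, 0 < th <= 2 * d -> S th = 0 -> discrete_mode t th]].
Proof.
have [K1 K10 HK1] := small_coercive R p0.
have [K2 K20 HK2] := top_coef_bound R p0.
have e0 : 0 < (4 * (K1 + K2))^-1 by rewrite invr_gt0 mulr_gt0 ?addr_gt0.
have [d1 /andP[d10 d11] Hd1] := penalty_small e0.
have [rho [C1 C10 HC1] Hrho] := trial_residuals.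
have [C2 C20 HC2] := trial_energy gamma p0.
pose d := Num.min 4^-1 (d1 / 2).
have d0 : 0 < d by rewrite lt_min invr_gt0 ltr0n divr_gt0.
have dd1 : 2 * d <= d1 by rewrite mulrC -ler_pdivlMr // ge_min lexx orbT.
have d4 : d <= 4^-1 by rewrite ge_min lexx.
exists d, (C2 + 4 * C1); split; [by rewrite d0|by rewrite addr_ge0 ?mulr_ge0|].
move=> t /andP[t0 td].
have t4 : t ^+ 2 <= 4^-1.
  rewrite expr2 -[4^-1]mul1r ler_pM ?(ltW t0) //; last exact: le_trans td d4.
  by rewrite (le_trans td) // (le_trans d4) // invf_le1 // ler1n.
have pK th : 0 < th <= 2 * d ->
    `|penalty gamma th| * K1 <= 4^-1 /\ `|penalty gamma th| * K2 <= 4^-1.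
  move=> /andP[th0 thd]; have H : `|penalty gamma th| * (K1 + K2) <= 4^-1.
    rewrite -ler_pdivlMr ?addr_gt0 // -invfM Hd1 // th0 /=.
    exact: le_trans thd dd1.
  by split; apply: le_trans _ H; rewrite ler_wpM2l // ?lerDl ?lerDr ltW.
have co0 : coercive p t 0 by apply: HK1; rewrite ?normr0 ?mul0r ?invr_ge0.
have [A0 [sA0 A00 A01 hA0]] := harmonic_ext p0 1 0 co0.
have [A1 [sA1 A10 A11 hA1]] := harmonic_ext p0 0 1 co0.
have [g bg hg] := load_response co0.
have nz th : 0 < th <= 2 * d -> 1 + penalty gamma th * top_coef p g != 0.
  by move=> /pK[_ H]; apply: (load_response_bound bg hg co0 K20 HK2 H).
pose u j th := penalized p A0 A1 g (penalty gamma th) (cosn j (- (th / 2))) (cosn j (th / 2)).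
have wc j th : 0 < th <= 2 * d -> wave_component t th j (u j th).
  move=> D; have [sg g0 g1] := bg; split.
  - rewrite /u /penalized (leq_trans (size_polyD _ _)) // geq_max.
    rewrite (leq_trans (size_polyD _ _)) ?geq_max /= ?(leq_trans (size_scale_leq _ _)) //.
  - by rewrite /u /penalized !hornerD !hornerZ A00 A10 g0 !mulr0 mulr1 !addr0.
  - by rewrite /u /penalized !hornerD !hornerZ A01 A11 g1 !mulr0 mulr1 addr0 add0r.
  - exact: (penalized_harmonic hA0 hA1 hg _ _ (nz th D)).
pose E j th := ref_form p t (penalty gamma th) (u j th) (u j th).
exists (fun th => E p.+1 th + E p.+2 th); split.
- move=> th D.
  have cl j : {for th, continuous (fun th => cosn j (- (th / 2)))}.
    rewrite (_ : (fun th => _) = (fun th => cosn j (- 2^-1 * th))).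
      exact: cosn_half_continuous.
    by apply/funext => x; congr cosn; rewrite mulNr mulrC.
  have cr j : {for th, continuous (fun th => cosn j (th / 2))}.
    rewrite (_ : (fun th => _) = (fun th => cosn j (2^-1 * th))).
      exact: cosn_half_continuous.
    by apply/funext => x; congr cosn; rewrite mulrC.
  have cs j : {for th, continuous (fun th => load_coef p A0 A1 g (penalty gamma th)
      (cosn j (- (th / 2))) (cosn j (th / 2)))}.
    apply: cvgM.
      apply: cvgN; apply: cvgM; first exact: penalty_continuous.
      by apply: cvgD; apply: cvgM; [exact: cl|exact: cvg_cst|exact: cr|exact: cvg_cst].
    apply: cvgV; first exact: nz.
    apply: cvgD; first exact: cvg_cst.
    by apply: cvgM; [exact: penalty_continuous|exact: cvg_cst].
  have cM (f1 f2 : R -> R) : {for th, continuous f1} -> {for th, continuous f2} ->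
      {for th, continuous (fun x => f1 x * f2 x)} by move=> H1 H2; exact: cvgM.
  have cD (f1 f2 : R -> R) : {for th, continuous f1} -> {for th, continuous f2} ->
      {for th, continuous (fun x => f1 x + f2 x)} by move=> H1 H2; exact: cvgD.
  have cC (k : R) : {for th, continuous (fun=> k : R)} by exact: cvg_cst.
  have cX (f : R -> R) : {for th, continuous f} ->
      {for th, continuous (fun x => f x ^+ 2)}.
    by move=> H; apply: (cM f f).
  have cE j : {for th, continuous (E j)}.
    pose a (x : R) := cosn j (- (x / 2)); pose c (x : R) := cosn j (x / 2).
    pose s (x : R) := load_coef p A0 A1 g (penalty gamma x) (a x) (c x).
    have -> : E j = (fun x => a x ^+ 2 * ref_form p t 0 A0 A0
      + c x ^+ 2 * ref_form p t 0 A1 A1 + 2 * a x * c x * ref_form p t 0 A0 A1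
      + s x ^+ 2 * top_coef p g + penalty gamma x
        * (a x * top_coef p A0 + c x * top_coef p A1 + s x * top_coef p g) ^+ 2).
      by apply/funext => x; exact: (penalized_energy hA0 hA1 bg hg).
    apply: (cD); last first.
      apply: (cM (penalty gamma)); first exact: penalty_continuous.
      apply: (cX); apply: (cD); last exact: (cM _ _ (cs j) (cC _)).
      exact: (cD _ _ (cM _ _ (cl j) (cC _)) (cM _ _ (cr j) (cC _))).
    apply: (cD); last exact: (cM _ _ (cX _ (cs j)) (cC _)).
    apply: (cD); last exact: (cM _ _ (cM _ _ (cM _ _ (cC 2) (cl j)) (cr j)) (cC _)).
    exact: (cD _ _ (cM _ _ (cX _ (cl j)) (cC _)) (cM _ _ (cX _ (cr j)) (cC _))).
  by apply: (cD (E p.+1) (E p.+2)); exact: cE.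
- move=> th thd Dz; have th0 : 0 < th <= 2 * d by case: Dz => /= /andP[-> _] _.
  have [rho0 Hr] := Hrho _ Dz.
  have [K1th _] := pK th th0.
  have gap j : j = p.+1 \/ j = p.+2 ->
    `|E j th - ref_form p t (penalty gamma th) (trial p j th) (trial p j th)|
      <= 2 * rho (th, t).
    move=> jj; have [su u0 u1 hu] := wc j th th0.
    apply: harmonic_gap su (size_trial p0 j th) _ _ hu _ rho0 _.
    - by rewrite u0 trial0.
    - by rewrite u1 trial1.
    - exact: HK1.
    - by move=> b bb; exact: (Hr j b jj bb).
  have Ga := gap p.+1 (or_introl erefl); have Gb := gap p.+2 (or_intror erefl).
  have Hc := HC2 _ Dz; have H1 := HC1 _ Dz; rewrite ger0_norm // in H1.
  move: Ga Gb Hc; rewrite /trial_sum /= !ler_norml => /andP[a1 a2] /andP[b1 b2] /andP[c1 c2].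
  by apply/andP; split; lra.
- move=> th D S0; exists (u p.+1 th), (u p.+2 th).
  by split; [exact: wc | exact: wc | exact: S0].
Qed.

End DispersionFunction.

Section RootLocation.
Local Open Scope classical_set_scope.
Variables (R : realType) (p : nat) (gamma : R).
Hypothesis p0 : (0 < p)%N.
Implicit Types (t th : R).
Local Notation kappa := (phase_coef p gamma).

Lemma dist_expr (x y B : R) n : 0 <= x <= B -> 0 <= y <= B ->
  `|x ^+ n.+1 - y ^+ n.+1| <= `|x - y| * (n.+1%:R * B ^+ n).
Proof.
move=> /andP[x0 xB] /andP[y0 yB]; rewrite subrXX normrM ler_wpM2l //.
apply: le_trans (ler_norm_sum _ _ _) _.
rewrite -[n.+1 in leRHS]card_ord -sum1_card natr_sum mulr_suml.
apply: ler_sum => i _; rewrite mul1r ger0_norm ?mulr_ge0 ?exprn_ge0 //.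
have B0 := le_trans x0 xB.
have -> : B ^+ n = B ^+ (n.+1.-1 - i) * B ^+ i.
  by rewrite -exprD subnK // -ltnS.
by rewrite ler_pM ?exprn_ge0 // lerXn2r ?nnegrE.
Qed.

(** Two values of [th] at which the dispersion function has opposite signs are
    found by shifting [th^2] away from its predicted value by [M t^(2 p + 4)]. *)
Lemma discrete_root : exists d C : R, [/\ 0 < d, 0 < C &
  forall t, 0 < t <= d -> exists th, [/\ 0 < th, discrete_mode p gamma t th &
    `| `|t - th| - 2^-1 * `|kappa| * t ^+ (2 * p + 1)| <= C * t ^+ (2 * p + 3)]].
Proof.
have [d [K [/andP[d0 d4] K0 HS]]] := mode_function gamma p0.
move: (phase_coef p gamma) HS => ka HS.
have [a Ea] : {a : R | a = `|ka|} by exists `|ka|.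
have a0 : 0 <= a by rewrite Ea.
have [C1 EC1] : {c : R | c = (a + 1) * (p.+1%:R * 2 ^+ p)} by exact: exist.
have [C2 EC2] : {c : R | c = a * C1 + K * (2 ^+ (p + 2) + 2 * (a + 1))} by exact: exist.
have C10 : 0 <= C1 by rewrite EC1 mulr_ge0 ?addr_ge0 ?mulr_ge0 ?exprn_ge0.
have C20 : 0 <= C2.
  by rewrite EC2 addr_ge0 ?mulr_ge0 ?addr_ge0 ?mulr_ge0 ?addr_ge0 ?exprn_ge0.
have [M EM] : {c : R | c = C2 + 1} by exact: exist.
have M0 : 0 < M by rewrite EM ltr_wpDl.
(* [M] exceeds the constant [C2] of the error terms, which does not depend on [M];
   [t <= 1 / (2 L)] then keeps the shifted values of [th] in the range of the
   estimates. *)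
have [L EL] : {c : R | c = M + a + 1} by exact: exist.
have L0 : 0 < L by rewrite EL -addrA ltr_pwDl // addr_ge0.
exists (Num.min d (2 * L)^-1), (M + (a + 1) ^+ 2); split.
- by rewrite lt_min d0 invr_gt0 mulr_gt0.
- by rewrite ltr_pwDl // sqr_ge0.
move=> t /andP[t0]; rewrite le_min => /andP[td tL].
have Lt : L * t <= 2^-1.
  by rewrite mulrC -ler_pdivlMr // -invfM.
have t1 : t <= 4^-1 by exact: le_trans td d4.
have tt : t ^+ 2 <= t by rewrite expr2 ler_piMl ?(ltW t0) //; lra.
have tle1 : t <= 1 by lra.
have [T ET] : {c : R | c = t ^+ (2 * p)} by exact: exist.
have T0 : 0 < T by rewrite ET exprn_gt0.
have Tt : T <= t ^+ 2 by rewrite ET ler_wiXn2l ?(ltW t0) // leq_pmulr.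
have t20 : 0 < t ^+ 2 by rewrite exprn_gt0.
have Mt : M * t ^+ 2 <= 1.
  have : M * t ^+ 2 <= L * t.
    by rewrite ler_pM ?(ltW M0) ?(ltW t20) // EL -addrA lerDl addr_ge0.
  lra.
have at2 : (a + 1) * t ^+ 2 <= 2^-1.
  apply: le_trans Lt; rewrite ler_pM ?addr_ge0 ?(ltW t20) //.
  by rewrite EL -addrA lerDr ltW.
have [S [cS eS zS]] := HS t (introT andP (conj t0 td)).
pose near th := `|th ^+ 2 - t ^+ 2 + ka * (T * t ^+ 2)| <= M * (T * t ^+ 4).
have nearP th : 0 < th -> near th ->
  [/\ `|th ^+ 2 - t ^+ 2| <= (a + 1) * (T * t ^+ 2), th <= 2 * t, wave_dom (th, t) &
     `|S th - (th ^+ 2 - t ^+ 2 + ka * (T * t ^+ 2))| <= C2 * (T * t ^+ 4)].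
  move=> th0 nth.
  have D1 : `|th ^+ 2 - t ^+ 2| <= (a + 1) * (T * t ^+ 2).
    rewrite -[_ - _](addrK (ka * (T * t ^+ 2))).
    apply: le_trans (ler_normB _ _) _; rewrite mulrDl mul1r [leRHS]addrC lerD //; last first.
      by rewrite normrM -Ea (ger0_norm (_ : 0 <= T * _)) // mulr_ge0 // ltW.
    apply: le_trans nth _; rewrite (_ : M * _ = M * t ^+ 2 * (T * t ^+ 2)); last by ring.
    by rewrite ler_piMl // mulr_ge0 // ltW.
  have D2 : (a + 1) * (T * t ^+ 2) <= 2^-1 * t ^+ 2.
    rewrite mulrA ler_wpM2r ?(ltW t20) //; apply: le_trans at2.
    by rewrite ler_wpM2l // addr_ge0.
  have D3 : `|th ^+ 2 - t ^+ 2| <= 2^-1 * t ^+ 2 by exact: le_trans D1 D2.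
  move: (D3); rewrite ler_norml => /andP[D4 D5].
  have tht : th ^+ 2 <= 2 * t ^+ 2 by lra.
  have t2t : 0 <= 2 * t ^+ 2 by rewrite mulr_ge0 // ltW.
  have th2 : th <= 2 * t.
    by rewrite -(@ler_pXn2r _ 2) ?nnegrE ?mulr_ge0 ?ltW // exprMn; lra.
  have Dz : wave_dom (th, t).
    split => /=; first by rewrite th0 /=; lra.
    rewrite t0 /= -(@ler_pXn2r _ 2) ?nnegrE ?mulr_ge0 ?ltW // exprMn; lra.
  split => //.
  have thd : th <= 2 * d by lra.
  have E1 := eS th thd Dz.
  have X : `|(th ^+ 2) ^+ p.+1 - (t ^+ 2) ^+ p.+1| <= C1 * (T * t ^+ 4).
    apply: le_trans (@dist_expr _ _ (2 * t ^+ 2) p _ _) _.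
    - by rewrite sqr_ge0.
    - by rewrite sqr_ge0 ler_peMl ?ler1n // ltW.
    rewrite exprMn -exprM -ET EC1 (_ : _ * (T * t ^+ 4) =
      (a + 1) * (T * t ^+ 2) * (p.+1%:R * (2 ^+ p * t ^+ 2))); last by ring.
    apply: ler_pM => //; first by rewrite !mulr_ge0 ?exprn_ge0 // ltW.
    by rewrite !ler_wpM2l ?exprn_ge0.
  have eT : T * t ^+ 2 = (t ^+ 2) ^+ p.+1.
    by rewrite ET -exprM mulnS addnC exprD.
  have eth : th ^+ (2 * p + 2) = (th ^+ 2) ^+ p.+1.
    by rewrite -exprM mulnS addnC.
  have X2 : `|ka * (th ^+ (2 * p + 2) - T * t ^+ 2)| <= a * C1 * (T * t ^+ 4).
    by rewrite normrM -Ea eth eT -mulrA ler_wpM2l.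
  have G : gauge p (th, t) <= (2 ^+ (p + 2) + 2 * (a + 1)) * (T * t ^+ 4).
    rewrite /gauge /delta /= mulrDl lerD //.
      rewrite (_ : (2 * p + 4 = 2 * (p + 2))%N); last by rewrite mulnDr.
      rewrite (_ : T * t ^+ 4 = (t ^+ 2) ^+ (p + 2)); last first.
        by rewrite ET exprD -!exprM.
      rewrite exprM -exprMn lerXn2r ?nnegrE ?sqr_ge0 //.
    rewrite (_ : 2 * (a + 1) * _ = (a + 1) * (T * t ^+ 2) * (2 * t ^+ 2)); last by ring.
    by rewrite ler_pM ?sqr_ge0.
  have G2 : K * gauge p (th, t) <= K * (2 ^+ (p + 2) + 2 * (a + 1)) * (T * t ^+ 4).
    by rewrite -mulrA ler_wpM2l.
  rewrite EC2 mulrDl; apply: le_trans (lerD X2 (le_trans E1 G2)).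
  apply: le_trans (ler_normD _ _); rewrite /delta /= le_eqVlt; apply/orP; left.
  by apply/eqP; congr `| _ |; ring.
have Tt4 : 0 < T * t ^+ 4 by rewrite mulr_gt0 ?exprn_gt0.
(* The squares of the two candidates for [th]. *)
pose xm : R := t ^+ 2 - ka * (T * t ^+ 2) - M * (T * t ^+ 4).
pose xp : R := t ^+ 2 - ka * (T * t ^+ 2) + M * (T * t ^+ 4).
have MT : 0 < M * (T * t ^+ 4) by rewrite mulr_gt0.
have xmp : xm < xp by rewrite /xm /xp; lra.
have xm0 : 0 < xm.
  have H1 : `|ka * (T * t ^+ 2)| <= a * (T * t ^+ 2).
    by rewrite normrM -Ea (ger0_norm (_ : 0 <= T * _)) // mulr_ge0 // ltW.
  have H2 : M * (T * t ^+ 4) <= T * t ^+ 2.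
    rewrite (_ : M * _ = M * t ^+ 2 * (T * t ^+ 2)); last by ring.
    by rewrite ler_piMl // mulr_ge0 // ltW.
  have H3 : (a + 1) * (T * t ^+ 2) <= 2^-1 * t ^+ 2.
    rewrite mulrA ler_wpM2r ?(ltW t20) //; apply: le_trans at2.
    by rewrite ler_wpM2l // addr_ge0.
  move: H1; rewrite ler_norml => /andP[_ H1]; rewrite /xm mulrDl mul1r in H3 *; lra.
pose thm := Num.sqrt xm; pose thp := Num.sqrt xp.
have xp0 := lt_trans xm0 xmp.
have sqm : thm ^+ 2 = xm by rewrite sqr_sqrtr // ltW.
have sqp : thp ^+ 2 = xp by rewrite sqr_sqrtr // ltW.
have thm0 : 0 < thm by rewrite sqrtr_gt0.
have thp0 : 0 < thp by rewrite sqrtr_gt0.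
have nearE th : near th = (xm <= th ^+ 2 <= xp).
  by rewrite /near ler_norml /xm /xp; congr (_ && _); apply/idP/idP; lra.
have nm : near thm by rewrite nearE sqm lexx ltW.
have np : near thp by rewrite nearE sqp lexx ltW.
have [_ _ _ Sm] := nearP thm thm0 nm; have [_ thp2 _ Sp] := nearP thp thp0 np.
have Sm0 : S thm < 0.
  move: Sm; rewrite sqm /xm ler_norml => /andP[_]; rewrite EM; lra.
have Sp0 : 0 < S thp.
  move: Sp; rewrite sqp /xp ler_norml => /andP[H _]; move: H; rewrite EM; lra.
have mp : thm <= thp by rewrite ler_sqrt // ltW.
have cont : {within `[thm, thp], continuous S}.
  apply: continuous_in_subspaceT => x; rewrite inE /= in_itv /= => /andP[x1 x2].
  by apply: cS; rewrite (lt_le_trans thm0 x1) /=; lra.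
have sgn : Num.min (S thm) (S thp) <= 0 <= Num.max (S thm) (S thp).
  by rewrite ge_min le_max (ltW Sm0) (ltW Sp0) orbT.
have [th] := IVT mp cont sgn; rewrite in_itv /= => /andP[th1 th2] Sth.
have th0 : 0 < th by exact: lt_le_trans th1.
have nth : near th.
  rewrite nearE -sqm -sqp; apply/andP.
  by split; rewrite lerXn2r ?nnegrE ?(ltW th0) ?(ltW thm0) ?(ltW thp0).
have [D1 th2t _ _] := nearP th th0 nth.
exists th; split => //.
  by apply: zS => //; rewrite th0 /=; lra.
pose e := th - t.
have eb : `|e| <= (a + 1) * (T * t).
  rewrite -(ler_pM2r t0); apply: (@le_trans _ _ `|th ^+ 2 - t ^+ 2|); last first.
    by apply: le_trans D1 _; rewrite le_eqVlt; apply/orP; left; apply/eqP; ring.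
  rewrite (_ : th ^+ 2 - t ^+ 2 = e * (th + t)); last by rewrite /e; ring.
  by rewrite normrM ler_wpM2l // ger0_norm; lra.
have e2 : e ^+ 2 <= (a + 1) ^+ 2 * (T * t ^+ 4).
  rewrite -real_normK ?num_real //.
  apply: (@le_trans _ _ (((a + 1) * (T * t)) ^+ 2)).
    by rewrite lerXn2r ?nnegrE // mulr_ge0 ?addr_ge0 // mulr_ge0 // ltW.
  rewrite exprMn ler_wpM2l ?sqr_ge0 // (_ : (T * t) ^+ 2 = T * (t ^+ 2 * T)); last by ring.
  rewrite ler_wpM2l ?(ltW T0) // (_ : t ^+ 4 = t ^+ 2 * t ^+ 2); last by ring.
  by rewrite ler_wpM2l // ltW.
have main : `|e + 2^-1 * ka * (T * t)| <= (M + (a + 1) ^+ 2) * (T * t ^+ 3).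
  rewrite -(ler_pM2r (_ : 0 < 2 * t)) ?mulr_gt0 //.
  rewrite -[X in _ * X <= _](gtr0_norm (_ : 0 < 2 * t)) ?mulr_gt0 // -normrM.
  rewrite (_ : _ * (2 * t) = th ^+ 2 - t ^+ 2 + ka * (T * t ^+ 2) - e ^+ 2); last first.
    by rewrite /e; field.
  apply: le_trans (ler_normB _ _) _; rewrite (ger0_norm (sqr_ge0 e)).
  apply: le_trans (lerD nth e2) _; rewrite -mulrDl.
  rewrite (_ : _ * (2 * t) = 2 * ((M + (a + 1) ^+ 2) * (T * t ^+ 4))); last by ring.
  apply: ler_peMl; last by rewrite ler1n.
  by rewrite mulr_ge0 ?(ltW Tt4) // addr_ge0 ?sqr_ge0 ?(ltW M0).
rewrite [t ^+ (2 * p + 1)]exprD [t ^+ (2 * p + 3)]exprD -ET expr1; apply: le_trans main.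
rewrite [`|t - th|]distrC -/e; apply: le_trans (_ : `| `|e| - `|- (2^-1 * ka * (T * t))| | <= _).
  rewrite normrN !normrM (ger0_norm (_ : 0 <= 2^-1)) ?invr_ge0 //.
  by rewrite (ger0_norm (ltW T0)) (ger0_norm (ltW t0)) !mulrA.
by apply: le_trans (ler_dist_dist _ _) _; rewrite opprK.
Qed.

End RootLocation.

(** * Piecewise polynomials and the bilinear form on the line *)

Section LocalPoly.
Local Open Scope classical_set_scope.
Variable R : realType.
Implicit Types (f u v w : R -> R) (q r : {poly R}) (a b x h : R).
Local Notation mu := (@lebesgue_measure R).

Lemma derive1_poly_oo f q a b : {in `]a, b[%R, f =1 horner q} ->
  {in `]a, b[%R, derive1 f =1 horner (q^`()%R)}.
Proof.
move=> fq x xab; rewrite derivE !derive1E; apply: near_eq_derive.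
by near=> y; apply: fq; near: y; exact: near_in_itvoo.
Unshelve. all: by end_near. Qed.

Lemma derive1n_poly_oo n f q a b : {in `]a, b[%R, f =1 horner q} ->
  {in `]a, b[%R, derive1n n f =1 horner (q^`(n)%R)}.
Proof.
move=> fq; elim: n => [|n IH]; first by rewrite derivn0.
by rewrite derivnS; exact: derive1_poly_oo IH.
Qed.

Lemma jump_cst w (a b x cl cr : R) : a < x -> x < b ->
  {in `]a, x[%R, w =1 fun=> cl} -> {in `]x, b[%R, w =1 fun=> cr} ->
  jump w x = cl - cr.
Proof.
move=> ax xb wl wr; rewrite /jump; congr (_ - _).
  apply: lim_near_cst => //; near=> y; apply: wl; rewrite in_itv /=.
  by apply/andP; split; near: y; [exact: nbhs_left_gt|exact: nbhs_left_lt].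
apply: lim_near_cst => //; near=> y; apply: wr; rewrite in_itv /=.
by apply/andP; split; near: y; [exact: nbhs_right_gt|exact: nbhs_right_lt].
Unshelve. all: by end_near. Qed.

(** Changing a function at the two end points preserves measurability and the
    integral, so all four kinds of interval are covered at once. *)
Lemma integral_poly_oo f q a b (c0 c1 : bool) : a < b -> {in `]a, b[%R, f =1 horner (q^`()%R)} ->
  measurable_fun [set` Interval (BSide c0 a) (BSide c1 b)] f /\
  (\int[mu]_(x in [set` Interval (BSide c0 a) (BSide c1 b)]) (f x)%:E
    = (q.[b] - q.[a])%:E)%E.
Proof.
move=> ab fq.
have cq (r : {poly R}) : continuous (horner r) by exact: continuous_horner.
have mo : measurable_fun `]a, b[ f.
  apply: (eq_measurable_fun (horner (q^`()%R))).
    by move=> x; rewrite inE /= => /fq ->.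
  by apply: measurable_funTS; apply: continuous_measurable_fun; exact: cq.
have mc : measurable_fun `[a, b] f by exact: (@measurable_fun_itv_cc _ _ _ false true).
split.
  apply: measurable_funS mc => //; apply: subset_itv; rewrite ?bnd_simp //.
rewrite integral_itv_bndoo //; last exact/measurable_EFinP.
transitivity (\int[mu]_(x in `]a, b[) (q^`()%R.[x])%:E)%E.
  by apply: eq_integral => x; rewrite inE /= => /fq ->.
rewrite -(@integral_itv_bndoo _ a b _ true false); last first.
  apply/measurable_EFinP; apply: measurable_funTS.
  by apply: continuous_measurable_fun; exact: cq.
rewrite (@continuous_FTC2 _ _ (horner q)) //.
- by apply: continuous_subspaceT; exact: cq.
- split.
  + by move=> x _; exact: derivable_horner.
  + by apply: cvg_at_right_filter; exact: cq.
  + by apply: cvg_at_left_filter; exact: cq.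
- by move=> x _; rewrite derivE.
Qed.

End LocalPoly.

Section Pieces.
Local Open Scope classical_set_scope.
Local Open Scope ring_scope.
Variable R : realType.
Implicit Types (f u v w : R -> R) (q r : {poly R}) (a b x h : R).
Local Notation mu := (@lebesgue_measure R).

(** The values at [a], [b] and [c] are left free because elementwise derivatives
    are not defined there. *)
Lemma Rintegral_two_pieces f q1 q2 a b c : a < b -> b < c ->
  {in `]a, b[%R, f =1 horner (q1^`()%R)} ->
  {in `]b, c[%R, f =1 horner (q2^`()%R)} ->
  (forall x, ~~ (a <= x <= c) -> f x = 0) ->
  \int[mu]_(x in [set: R]) f x = (q1.[b] - q1.[a]) + (q2.[c] - q2.[b]).
Proof.
move=> ab bc f1 f2 f0.
have -> : \int[mu]_(x in [set: R]) f x = \int[mu]_(x in `[a, c]%classic) f x.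
  rewrite [RHS]Rintegral_mkcond; congr (Rintegral _ _ _).
  apply/funext => x; rewrite patchE; case: ifPn => // xac; apply: f0.
  by apply: contra xac => xac; rewrite inE /= in_itv.
have [m1 i1] := integral_poly_oo true true ab f1.
have [m2 i2] := integral_poly_oo true false bc f2.
rewrite /Rintegral (@itv_bndbnd_setU _ _ _ (BLeft b)) ?bnd_simp ?ltW //.
rewrite integral_setU_EFin //=.
- by rewrite i1 i2.
- by apply/measurable_funU.
- apply/disj_setPS => x [] /=; rewrite !in_itv /= => /andP[_ xb] /andP[bx _].
  by rewrite ltNge bx in xb.
Qed.

(** [U j] is the polynomial of the cell that starts at [j h], in the coordinate of
    the reference cell. *)
Definition pieces h u (U : int -> {poly R}) := forall (j : int) x,
  j%:~R * h <= x <= (j + 1)%:~R * h -> u x = (U j).[x / h - j%:~R].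

Definition place h (j : int) q : {poly R} := q \Po (h^-1 *: 'X - (j%:~R)%:P).

Lemma horner_place h j q x : (place h j q).[x] = q.[x / h - j%:~R].
Proof. by rewrite horner_comp !hornerE mulrC. Qed.

Lemma deriv_place h j q : (place h j q)^`() = h^-1 *: place h j q^`().
Proof.
rewrite /place deriv_comp derivB derivC subr0 derivZ derivX.
by rewrite -mul_polyC mulr1 mulrC mul_polyC.
Qed.

Lemma derivn_place n h j q : (place h j q)^`(n) = h^-1 ^+ n *: place h j q^`(n).
Proof.
elim: n => [|n IH]; first by rewrite !derivn0 expr0 scale1r.
by rewrite !derivnS IH derivZ deriv_place scalerA exprSr.
Qed.

Lemma pieces_oo h u U j : 0 < h -> pieces h u U ->
  {in `]j%:~R * h, (j + 1)%:~R * h[%R, u =1 horner (place h j (U j))}.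
Proof.
move=> h0 uU x; rewrite in_itv /= => /andP[x1 x2].
by rewrite horner_place; apply: uU; rewrite !ltW.
Qed.

Lemma mesh_lt h (j : int) : 0 < h -> j%:~R * h < (j + 1)%:~R * h :> R.
Proof. by move=> h0; rewrite ltr_pM2r // ltr_int ltrDl. Qed.

Variable p : nat.

Lemma jump_pieces h u U (j : int) : 0 < h -> pieces h u U ->
  (forall i, (size (U i) <= p.+1)%N) ->
  jump (derive1n p u) (j%:~R * h) =
    h^-1 ^+ p * (top_coef p (U (j - 1)) - top_coef p (U j)).
Proof.
move=> h0 uU sU.
have cst i : {in `]i%:~R * h, (i + 1)%:~R * h[%R,
    derive1n p u =1 fun=> h^-1 ^+ p * top_coef p (U i)}.
  move=> x xi; rewrite (derive1n_poly_oo p (pieces_oo h0 uU) xi).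
  rewrite derivn_place hornerZ horner_place /top_coef; congr (_ * _).
  have /size1_polyC -> : (size (U i)^`(p) <= 1)%N by rewrite size_derivn_leq // addn1.
  by rewrite !hornerC.
have cl := cst (j - 1); rewrite subrK in cl.
rewrite (jump_cst _ _ cl (cst j)) ?mesh_lt //; last first.
  by rewrite -{2}(subrK 1 j) mesh_lt.
by rewrite mulrBr.
Qed.

Lemma energy_pieces h k u v U V : 0 < h -> pieces h u U -> pieces h v V ->
  (forall j, j != -1 -> j != 0 -> V j = 0) ->
  \int[mu]_(x in [set: R]) (derive1 u x * derive1 v x - k ^+ 2 * (u x * v x))
  = h^-1 * (ref_form p (k * h) 0 (U (-1)) (V (-1)) + ref_form p (k * h) 0 (U 0) (V 0)).
Proof.
move=> h0 uU vV V0; have hn0 : h != 0 by rewrite gt_eqF.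
pose Q j := h^-1 *: place h j (antideriv ((U j)^`() * (V j)^`())) -
   (k ^+ 2 * h) *: place h j (antideriv (U j * V j)).
have fq j : {in `]j%:~R * h, (j + 1)%:~R * h[%R,
    (fun x => derive1 u x * derive1 v x - k ^+ 2 * (u x * v x)) =1 horner (Q j)^`()}.
  move=> x xj; have pu := pieces_oo (j := j) h0 uU; have pv := pieces_oo (j := j) h0 vV.
  rewrite (derive1_poly_oo pu xj) (derive1_poly_oo pv xj) (pu x xj) (pv x xj).
  rewrite /Q derivB !derivZ !deriv_place !antiderivK.
  rewrite /place !comp_polyM -!/(place h j _) !(hornerD, hornerN, hornerZ, hornerM).
  by field.
have QE j : (Q j).[(j + 1)%:~R * h] - (Q j).[j%:~R * h] =
    h^-1 * ref_form p (k * h) 0 (U j) (V j).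
  have e0 : j%:~R * h / h - j%:~R = 0 by rewrite mulfK // subrr.
  have e1 : (j + 1)%:~R * h / h - j%:~R = 1 by rewrite mulfK // intrD addrAC subrr add0r.
  rewrite /Q !(hornerD, hornerN, hornerZ) !horner_place e0 e1 /ref_form mul0r addr0.
  have E q : poly_int q = (antideriv q).[1] - (antideriv q).[0].
    by rewrite -poly_int_deriv antiderivK.
  by rewrite !E; field.
have f1 := fq (-1); have f2 := fq 0; rewrite addNr in f1; rewrite add0r in f2.
have m0 := mesh_lt (-1) h0; have m1 := mesh_lt 0 h0; rewrite addNr in m0; rewrite add0r in m1.
rewrite (Rintegral_two_pieces m0 m1 f1 f2).
  have E1 := QE (-1); have E0 := QE 0; rewrite addNr in E1; rewrite add0r in E0.
  by rewrite E1 E0 -mulrDr.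
have zero_on j : j != -1 -> j != 0 -> forall x, j%:~R * h <= x <= (j + 1)%:~R * h -> v x = 0.
  by move=> j1 j2 x xj; rewrite (vV j x xj) V0 // horner0.
have vout x : ~~ ((-1)%:~R * h <= x <= 1%:~R * h) -> v x = 0.
  move=> xo; pose j := Num.floor (x / h).
  have jx : j%:~R * h <= x <= (j + 1)%:~R * h.
    have := floor_itv (x / h); rewrite -/j => /andP[a1 a2].
    by rewrite -ler_pdivlMr // a1 -ler_pdivrMr //= ltW.
  apply: (zero_on j _ _ x jx); apply: contra xo => /eqP jE; move: jx; rewrite jE.
    rewrite addNr => /andP[-> a2] /=; apply: le_trans a2 _.
    by rewrite mul0r mul1r ltW.
  rewrite add0r => /andP[a1 ->]; rewrite andbT; apply: le_trans _ a1.
  by rewrite mul0r mulN1r oppr_le0 ltW.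
move=> x xo; rewrite (vout x xo) mulr0 mulr0 subr0.
suff -> : derive1 v x = 0 by rewrite mulr0.
have /= := derive1_poly_oo (f := v) (q := 0).
rewrite deriv0 => H.
have [xl|xr] : x < (-1)%:~R * h \/ 1%:~R * h < x.
  by move: xo; rewrite negb_and -!ltNge => /orP[]; [left|right].
- rewrite (H (x - 1) ((-1)%:~R * h)) ?horner0 //.
    move=> y; rewrite in_itv /= => /andP[_ y2]; rewrite horner0 vout //.
    by rewrite negb_and -ltNge y2.
  by rewrite in_itv /= xl andbT ltrBlDr ltrDl ltr01.
- rewrite (H (1%:~R * h) (x + 1)) ?horner0 //.
    move=> y; rewrite in_itv /= => /andP[y1 _]; rewrite horner0 vout //.
    by rewrite negb_and -!ltNge y1 orbT.
  by rewrite in_itv /= xr ltrDl ltr01.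
Qed.

Lemma fsbig_int_window (S : nmodType) (F : int -> S) (s : seq int) : uniq s ->
  (forall j, j \notin s -> F j = 0) ->
  \sum_(j \in [set: int]) F j = \sum_(j <- s) F j.
Proof.
move=> us Fs; rewrite (fsbig_seq _ _ us); apply/esym/fsbig_widen => // j [_ /=].
by move/negP/Fs.
Qed.

(** Scaling: the energy of a cell is [1 / h] times that of the reference cell, and
    [h^(2 p - 1)] times two factors [h^(-p)] from the derivatives is [1 / h] as well. *)
Lemma cip_form_pieces gamma k h u v U V : (0 < p)%N -> 0 < h ->
  pieces h u U -> pieces h v V ->
  (forall i, (size (U i) <= p.+1)%N) -> (forall i, (size (V i) <= p.+1)%N) ->
  (forall j, j != -1 -> j != 0 -> V j = 0) ->
  cip_form p gamma k h u v = h^-1 *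
    (ref_form p (k * h) 0 (U (-1)) (V (-1)) + ref_form p (k * h) 0 (U 0) (V 0)
     + gamma * \sum_(j <- [:: -1; 0; 1] : seq int)
        (top_coef p (U (j - 1)) - top_coef p (U j))
        * (top_coef p (V (j - 1)) - top_coef p (V j))).
Proof.
move=> p0 h0 uU vV sU sV V0; rewrite /cip_form (energy_pieces _ h0 uU vV V0).
rewrite (fsbig_int_window (s := [:: -1; 0; 1] : seq int)) //; last first.
  move=> j; rewrite !inE !negb_or => /and3P[j1 j2 j3].
  rewrite (jump_pieces _ h0 vV) // (V0 j) // (V0 (j - 1)).
  - by rewrite subrr !mulr0.
  - by rewrite subr_eq addNr.
  - by rewrite subr_eq add0r.
under eq_bigr do rewrite !(jump_pieces _ h0 uU, jump_pieces _ h0 vV) // mulrACA.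
rewrite -mulr_sumr [RHS]mulrDr; congr (_ + _); rewrite !mulrA; congr (_ * _).
rewrite [h^-1 * _]mulrC -!mulrA; congr (_ * _).
have hn0 : h != 0 by rewrite gt_eqF.
rewrite -exprD exprVn addnn -mul2n.
have -> : (2 * p = (2 * p - 1).+1)%N by rewrite subn1 prednK // muln_gt0.
by rewrite subn1 /= exprSr invfM mulrA mulfV ?mul1r // expf_neq0.
Qed.

End Pieces.

(** * The nodal basis *)

Section NodalBasis.
Local Open Scope classical_set_scope.
Local Open Scope ring_scope.
Variables (R : realType) (p : nat).
Hypothesis p0 : (0 < p)%N.
Implicit Types (q r : {poly R}) (x h : R) (i j m n : int) (l : nat).

Definition ref_node l : R := l%:R / p%:R.

Lemma ref_node_inj : injective ref_node.
Proof.
move=> a b /(mulIf _); rewrite invr_eq0 pnatr_eq0 -lt0n => /(_ p0) /eqP.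
by rewrite eqr_nat => /eqP.
Qed.

(** The Lagrange polynomial of the node [i], or zero if [i] is not one of
    [0, ..., p]; the latter lets all cells be treated alike. *)
Definition node_poly i : {poly R} :=
  \sum_(l < p.+1 | (l : nat)%:Z == i) (tnth (lagrange p.+1 ref_node) l : {poly R}).

Lemma size_node_poly i : (size (node_poly i) <= p.+1)%N.
Proof.
rewrite /node_poly; apply: leq_trans (size_sum _ _ _) _; apply/bigmax_leqP => l _.
by rewrite size_lagrange_ //; exact: ref_node_inj.
Qed.

Lemma node_poly_sample i l : (l <= p)%N -> (node_poly i).[ref_node l] = (i == l%:Z)%:R.
Proof.
move=> lp; rewrite horner_sum; pose l' := Ordinal (lp : (l < p.+1)%N).
have S (k : 'I_p.+1) : (tnth (lagrange p.+1 ref_node) k : {poly R}).[ref_node l] = (k == l')%:R.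
  by rewrite -[l]/(l' : nat) lagrange_sample //; exact: ref_node_inj.
under eq_bigr do rewrite S.
have [->|il] := eqVneq i l%:Z.
  rewrite (bigD1 l') //= eqxx big1 ?addr0 // => k /andP[_ kl].
  by rewrite (negPf kl).
rewrite big1 // => k /eqP ki; case: eqP => // kl; case/negP: il.
by rewrite -ki kl.
Qed.

Lemma node_poly_out i : (i < 0) || (p%:Z < i) -> node_poly i = 0.
Proof.
move=> io; rewrite /node_poly big1 // => l /eqP li.
by move: io; rewrite -li ltz_nat ltnNge -ltnS ltn_ord.
Qed.

Lemma ref_interp_inj q r : (size q <= p.+1)%N -> (size r <= p.+1)%N ->
  (forall l, (l <= p)%N -> q.[ref_node l] = r.[ref_node l]) -> q = r.
Proof.
move=> sq sr qr.
rewrite (lagrange_gen (ltn0Sn p) ref_node_inj sq) (lagrange_gen (ltn0Sn p) ref_node_inj sr).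
by apply: eq_bigr => l _; rewrite qr // -ltnS.
Qed.

Lemma node_poly_expand q : (size q <= p.+1)%N ->
  q = \sum_(l < p.+1) q.[ref_node l] *: node_poly (l : nat)%:Z.
Proof.
move=> sq; apply: ref_interp_inj => //.
  apply: leq_trans (size_sum _ _ _) _; apply/bigmax_leqP => l _.
  by rewrite (leq_trans (size_scale_leq _ _)) // size_node_poly.
move=> l lp; rewrite horner_sum (bigD1 (Ordinal (lp : (l < p.+1)%N))) //=.
rewrite hornerZ node_poly_sample // eqxx mulr1 big1 ?addr0 // => k kl.
rewrite hornerZ node_poly_sample // eqz_nat (_ : (k == l :> nat) = false) ?mulr0 //.
by apply/negbTE; apply: contra kl => /eqP kl; apply/eqP/val_inj.
Qed.

Variable h : R.
Hypothesis h0 : 0 < h.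

Let hn0 : h != 0. Proof. by rewrite gt_eqF. Qed.
Let pn0 : p%:R != 0 :> R. Proof. by rewrite pnatr_eq0 -lt0n. Qed.

Definition node_pieces m j : {poly R} := node_poly (m - j * p%:Z).

Lemma fem_nodeE j l : fem_node p h (j * p%:Z + l%:Z) = h * (j%:~R + ref_node l).
Proof.
rewrite /fem_node /ref_node intrD intrM -!pmulrn; field.
exact: pn0.
Qed.

Lemma size_comp_affine q (a b : R) : (size q <= p.+1)%N ->
  (size (q \Po (a *: 'X + b%:P))%R <= p.+1)%N.
Proof.
move=> sq; rewrite (leq_trans (size_comp_poly_leq _ _)) //.
have [->|qn0] := eqVneq q 0; first by rewrite size_poly0.
have s2 : (size (a *: 'X + b%:P : {poly R})%R <= 2)%N.
  rewrite (leq_trans (size_polyD _ _)) // geq_max.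
  rewrite (leq_trans (size_scale_leq _ _)) ?size_polyX //=.
  by rewrite (leq_trans (size_polyC_leq1 _)).
rewrite ltnS; apply: (@leq_trans ((size q).-1 * 1)).
  by rewrite leq_mul // -subn1 leq_subLR.
by rewrite muln1 -ltnS prednK ?size_poly_gt0.
Qed.

Lemma pieces_of_fem_space (u : R -> R) m : fem_space p h u ->
  (forall n, u (fem_node p h n) = (m == n)%:R) -> pieces h u (node_pieces m).
Proof.
move=> [_ uq] um j x xj; have [q [sq Hq]] := uq (j + 1).
have {}Hq y : j%:~R * h <= y <= (j + 1)%:~R * h -> u y = q.[y].
  by move=> yj; apply: Hq; rewrite addrK.
pose q' := q \Po (h *: 'X + (j%:~R * h)%:P).
have q'E y : q'.[y] = q.[h * (j%:~R + y)].
  by rewrite horner_comp !hornerE; congr horner; ring.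
suff -> : node_pieces m j = q'.
  by rewrite q'E Hq //; congr horner; field; exact: hn0.
apply: ref_interp_inj.
- exact: size_node_poly.
- exact: size_comp_affine.
move=> l lp; rewrite q'E -Hq -?fem_nodeE ?um.
  by rewrite /node_pieces node_poly_sample // subr_eq addrC.
rewrite fem_nodeE [h * _]mulrC !ler_pM2r // lerDl divr_ge0 //= intrD lerD2l.
by rewrite /ref_node ler_pdivrMr ?mul1r ?ltr0n // ler_nat.
Qed.

Definition clamp (y : R) := Num.max 0 (Num.min y 1).

Lemma clamp_continuous : continuous clamp.
Proof.
move=> y; apply: (@continuous_max _ _ (fun=> 0) (fun x : R => Num.min x 1)).
  exact: cvg_cst.
apply: (@continuous_min _ _ (fun x : R => x) (fun=> 1)); [exact: cvg_id | exact: cvg_cst].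
Qed.

Lemma clamp_le0 y : y <= 0 -> clamp y = 0.
Proof.
move=> y1; rewrite /clamp; apply/max_idPl.
by rewrite ge_min y1.
Qed.

Lemma clamp_ge1 y : 1 <= y -> clamp y = 1.
Proof. by move=> y1; rewrite /clamp (min_idPr y1); apply/max_idPr; exact: ler01. Qed.

Lemma clamp_id y : 0 <= y <= 1 -> clamp y = y.
Proof. by move=> /andP[y1 y2]; rewrite /clamp (min_idPl y2); apply/max_idPr. Qed.

(** Clamping the coordinate of a cell to [[0, 1]] extends a polynomial on that cell
    continuously by constants.  At most two cells matter for the node [m], and the
    subtracted constant accounts for the overlap. *)
Definition nodal_fun m x : R :=
  let J := (m %/ p)%Z in
  (node_pieces m J).[clamp (x / h - J%:~R)]
  + (node_pieces m (J - 1)).[clamp (x / h - (J - 1)%:~R)]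
  - (node_pieces m J).[0].

Lemma ref_node0 : ref_node 0 = 0. Proof. by rewrite /ref_node mul0r. Qed.
Lemma ref_node_p : ref_node p = 1. Proof. by rewrite /ref_node mulfV. Qed.

Lemma nodal_fun_pieces m : pieces h (nodal_fun m) (node_pieces m).
Proof.
move=> j x /andP[xj1 xj2].
rewrite -ler_pdivlMr // in xj1; rewrite -ler_pdivrMr // in xj2.
rewrite /nodal_fun; set J := (m %/ p)%Z; set y := x / h in xj1 xj2 *.
have pz : 0 < p%:Z by rewrite ltz_nat.
have mE := divz_eq m p%:Z; have m0 := modz_ge0 m (lt0r_neq0 pz).
have mp := ltz_pmod m pz; rewrite -/J in mE.
pose s := (m %% p)%Z; rewrite -/s in mE m0 mp.
have P i : node_pieces m i = node_poly (s + (J - i) * p%:Z).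
  by rewrite /node_pieces mE; congr node_poly; ring.
have at0 i : (node_poly i).[0] = (i == 0)%:R by have := node_poly_sample i (leq0n p); rewrite ref_node0.
have at1 i : (node_poly i).[1] = (i == p%:Z)%:R by have := node_poly_sample i (leqnn p); rewrite ref_node_p.
have sp : (s + p%:Z == p%:Z) = (s == 0) by rewrite -subr_eq0 addrK.
have yl (i : int) : i <= j -> 0 <= y - i%:~R.
  by move=> ij; rewrite subr_ge0 (le_trans _ xj1) // ler_int.
have yr (i : int) : j + 1 <= i -> y - i%:~R <= 0.
  by move=> ij; rewrite subr_le0 (le_trans xj2) // ler_int.
have out i : i < J - 1 \/ J < i -> node_pieces m i = 0.
  move=> iJ; rewrite P node_poly_out //; apply/orP.
  by case: iJ => iJ; [right|left]; nia.
have [jl|jr|jJ] := ltgtP j J.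
- rewrite (clamp_le0 (y := y - J%:~R)); last by apply: yr; lia.
  rewrite addrAC subrr add0r.
  have [jl1|jr1|jJ1] := ltgtP j (J - 1).
  + rewrite clamp_le0; last by apply: yr; lia.
    rewrite (out j); last by left.
    by rewrite horner0 P at0 (_ : _ == 0 = false) //; apply/negbTE; nia.
  + by lia.
  + by rewrite -jJ1 clamp_id // yl //= lerBlDr addrC -[1]/(1%:~R) -intrD.
- rewrite (out j); last by right.
  rewrite clamp_ge1; last first.
    by rewrite lerBrDr -[1]/(1%:~R) -intrD (le_trans _ xj1) // ler_int; lia.
  rewrite clamp_ge1; last first.
    by rewrite lerBrDr -[1]/(1%:~R) -intrD (le_trans _ xj1) // ler_int; lia.
  rewrite horner0 !P !at1 at0 subrr mul0r addr0.
  rewrite (_ : s + (J - (J - 1)) * p%:Z = s + p%:Z); last by ring.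
  by rewrite (lt_eqF mp) add0r sp subrr.
- rewrite jJ (clamp_id (y := y - J%:~R)); last first.
    by rewrite yl ?jJ //= lerBlDr addrC -[1]/(1%:~R) -intrD -jJ.
  rewrite clamp_ge1; last first.
    by rewrite lerBrDr intrD addrCA subrr addr0 -jJ.
  rewrite [node_pieces m (J - 1)]P at1 [in X in _ - X]P at0.
  rewrite (_ : s + (J - (J - 1)) * p%:Z = s + p%:Z); last by ring.
  by rewrite sp subrr mul0r addr0 addrK.
Qed.

Lemma nodal_fun_fem m : fem_space p h (nodal_fun m) /\
  forall n, nodal_fun m (fem_node p h n) = (m == n)%:R.
Proof.
have np := nodal_fun_pieces m; split.
  split.
    have cc (q : {poly R}) i :
        continuous (fun x => q.[clamp (x / h - i%:~R)]).
      move=> x; apply: (@continuous_comp _ _ _ (fun x => clamp (x / h - i%:~R)) (horner q)).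
        apply: (@continuous_comp _ _ _ (fun x => x / h - i%:~R) clamp).
          by apply: cvgB; [apply: cvgM; [exact: cvg_id|exact: cvg_cst]|exact: cvg_cst].
        exact: clamp_continuous.
      exact: continuous_horner.
    move=> x; apply: cvgB; last exact: cvg_cst.
    by apply: cvgD; exact: cc.
  move=> j; exists (place h (j - 1) (node_pieces m (j - 1))); split.
    by rewrite /place -polyCN; apply: size_comp_affine; exact: size_node_poly.
  by move=> x xj; rewrite horner_place (np (j - 1)) // subrK.
move=> n; pose j := (n %/ p)%Z.
have pz : 0 < p%:Z by rewrite ltz_nat.
have [l lE] : exists l : nat, (n %% p)%Z = l%:Z.
  by exists `|(n %% p)%Z|%N; rewrite gez0_abs // modz_ge0 // lt0r_neq0.
have lp : (l < p)%N by rewrite -ltz_nat -lE ltz_pmod.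
have nE : n = j * p%:Z + l%:Z by rewrite -lE -divz_eq.
have r0 : 0 <= ref_node l by rewrite divr_ge0.
have r1 : ref_node l <= 1 by rewrite ler_pdivrMr ?ltr0n // mul1r ler_nat ltnW.
rewrite {1}nE fem_nodeE (np j); last first.
  by rewrite [h * _]mulrC !ler_pM2r // lerDl r0 intrD lerD2l.
rewrite (_ : _ / h - _ = ref_node l); last by field; exact: hn0.
by rewrite node_poly_sample 1?ltnW // subr_eq addrC -nE.
Qed.

(** A function with the defining property exists by [nodal_fun_fem], and on every
    cell its polynomial is forced by interpolation. *)
Lemma nodal_basis_pieces m : pieces h (nodal_basis p h m) (node_pieces m).
Proof.
have [H1 H2] : [set u | fem_space p h u /\
    forall n : int, u (fem_node p h n) = (m == n)%:R] (nodal_basis p h m).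
  by apply: xgetPex; exists (nodal_fun m); exact: nodal_fun_fem.
exact: pieces_of_fem_space.
Qed.

End NodalBasis.

(** * The coefficient matrix on Bloch vectors *)

Section Bloch.
Local Open Scope classical_set_scope.
Local Open Scope ring_scope.
Local Open Scope complex_scope.
Variables (R : realType) (p : nat).
Hypothesis p0 : (0 < p)%N.
Implicit Types (a b u v : {poly R}) (th t h : R) (i j m : int).

Lemma expiD x (y : R) : expi (x + y) = expi x * expi y.
Proof. by rewrite /expi cosD sinD; simpc; congr (_ +i* _); ring. Qed.

Lemma expi0 : expi (0 : R) = 1.
Proof. by rewrite /expi cos0 sin0. Qed.

Lemma expi_int_succ th m : expi ((m + 1)%:~R * th) = expi (m%:~R * th) * expi th.
Proof. by rewrite intrD mulrDl mul1r expiD. Qed.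

Definition conj_pair (x y : R) : R[i] := x -i* y.

Lemma conj_pairE x y : conj_pair x y = x%:C - 'i * y%:C.
Proof. by rewrite /conj_pair; simpc; rewrite ?(addr0, add0r, mul0r, mulr0, sub0r, subr0). Qed.

(** The shifts by which a basis function attached to one cell can interact with
    one attached to another, through the jumps at both ends of a cell. *)
Definition window : seq int := [:: -2; -1; 0; 1; 2].

Variables (th : R) (u v : {poly R}).
Hypotheses (su : (size u <= p.+1)%N) (sv : (size v <= p.+1)%N).
Hypothesis quasi : conj_pair u.[1] v.[1] = expi th * conj_pair u.[0] v.[0].

Definition bloch_coef (l : nat) : R[i] := conj_pair u.[ref_node R p l] v.[ref_node R p l].

(** Only [m = j] and, for the vertex function, [m = j + 1] contribute on the cell
    [j]; the quasi-periodicity of [u - i v] makes the latter the missing last term of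
    the interpolation formula. *)
Lemma bloch_sum (F : {scalar {poly R}}) j : -2 <= j <= 1 ->
  \sum_(q < p) (\sum_(m <- window) expi (m%:~R * th)
     * (F (node_poly R p ((q : nat)%:Z + (m - j) * p%:Z)))%:C) * bloch_coef q
  = expi (j%:~R * th) * conj_pair (F u) (F v).
Proof.
move=> jw; have jin : (j \in window) && (j + 1 \in window).
  by move: jw; rewrite !inE; lia.
have [jin0 jin1] := andP jin.
have one m0 (A : R[i]) : m0 \in window ->
    \sum_(m <- window) (if m == m0 then A else 0) = A.
  by move=> mw; rewrite -big_mkcond -big_filter filter_pred1_uniq // big_seq1.
have inner (q : 'I_p) : \sum_(m <- window) expi (m%:~R * th)
     * (F (node_poly R p ((q : nat)%:Z + (m - j) * p%:Z)))%:C =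
   expi (j%:~R * th) * ((F (node_poly R p (q : nat)%:Z))%:C
     + expi th * (F (node_poly R p ((q : nat)%:Z + p%:Z)))%:C).
  have qp := ltn_ord q; set P := (q : nat)%:Z.
  have Pp : P < p%:Z by rewrite ltz_nat.
  have P0 : 0 <= P by [].
  pose A := expi (j%:~R * th) * (F (node_poly R p P))%:C.
  pose B := expi ((j + 1)%:~R * th) * (F (node_poly R p (P + p%:Z)))%:C.
  rewrite (eq_bigr (fun m => (if m == j then A else 0) + (if m == j + 1 then B else 0))).
    rewrite big_split /= !one // /A /B expi_int_succ mulrDr.
    by congr (_ + _); rewrite mulrA.
  move=> m _; have [->|mj] := eqVneq m j.
    rewrite subrr mul0r addr0 (_ : (j == j + 1) = false) ?addr0 //.
    by rewrite -subr_eq0 opprD addNKr.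
  have [->|mj1] := eqVneq m (j + 1).
    by rewrite add0r /B [j + 1]addrC addrK mul1r.
  rewrite addr0 node_poly_out ?linear0 ?mulr0 //; clear -mj mj1 Pp P0.
  have H : m - j <= -1 \/ 2 <= m - j by lia.
  by apply/orP; case: H => H; [left|right]; nia.
under eq_bigr do rewrite inner -mulrA.
rewrite -mulr_sumr; congr (_ * _).
have -> : conj_pair (F u) (F v) = \sum_(l < p.+1) (F (node_poly R p (l : nat)%:Z))%:C * bloch_coef l.
  rewrite {1}(node_poly_expand p0 su) {1}(node_poly_expand p0 sv) !linear_sum conj_pairE.
  rewrite !rmorph_sum mulr_sumr -sumrB; apply: eq_bigr => l _.
  rewrite !linearZ /= /bloch_coef conj_pairE !rmorphM /=; ring.
rewrite big_ord_recr /= /bloch_coef ref_node_p // quasi.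
under eq_bigr do rewrite mulrDl.
rewrite big_split /=; congr (_ + _).
rewrite (bigD1 (Ordinal p0)) //= big1 ?addr0.
  by rewrite /bloch_coef ref_node0 add0r; ring.
move=> q q0; rewrite node_poly_out ?linear0 ?mulr0 ?mul0r //.
rewrite -[X in X || _]orFb; apply/orP; right; rewrite ltrDr ltz_nat lt0n.
by apply: contra q0 => /eqP q0; apply/eqP/val_inj.
Qed.

End Bloch.

Section Assembly.
Local Open Scope classical_set_scope.
Local Open Scope ring_scope.
Local Open Scope complex_scope.
Variables (R : realType) (p : nat) (gamma k h : R).
Hypotheses (p0 : (0 < p)%N) (h0 : 0 < h).
Implicit Types (a b u v : {poly R}) (i j m n : int) (s : nat).
Local Notation t := (k * h).
Local Notation node := (node_poly R p).

(** The sum over jumps is rearranged by cells, which produces second differences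
    of the top coefficients of the test function. *)
Lemma cip_form_nodal n s : (s < p)%N ->
  let a := node (s%:Z + p%:Z) in let b := node s%:Z in
  let U j := node_pieces R p n j in
  cip_form p gamma k h (nodal_basis p h n) (nodal_basis p h s%:Z) =
  h^-1 * (ref_form p t 0 a (U (-1)) + ref_form p t 0 b (U 0)
    + gamma * (- top_coef p a * top_coef p (U (-2))
       + (2 * top_coef p a - top_coef p b) * top_coef p (U (-1))
       + (2 * top_coef p b - top_coef p a) * top_coef p (U 0)
       - top_coef p b * top_coef p (U 1))).
Proof.
move=> sp a b U; pose V j := node_pieces R p s%:Z j.
have spz : s%:Z < p%:Z by rewrite ltz_nat.
have V0 j : j != -1 -> j != 0 -> V j = 0.
  move=> j1 j2; rewrite /V /node_pieces node_poly_out //.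
  have s0 : 0 <= s%:Z by [].
  have H : j <= -2 \/ 1 <= j by lia.
  by apply/orP; case: H => H; [right|left]; nia.
rewrite (cip_form_pieces gamma k p0 h0 (nodal_basis_pieces p0 h0 n)
  (nodal_basis_pieces p0 h0 s%:Z)) //; try by move=> i; exact: size_node_poly.
rewrite !big_cons big_nil -!/(V _).
have Va : V (-1) = a by rewrite /V /node_pieces mulN1r opprK.
have Vb : V 0 = b by rewrite /V /node_pieces mul0r subr0.
rewrite (_ : -1 - 1 = -2 :> int) // (_ : 0 - 1 = -1 :> int) // (_ : 1 - 1 = 0 :> int) //.
rewrite Va Vb (V0 (-2)) // (V0 1) // linear0.
rewrite [ref_form p t 0 _ a]ref_formC [ref_form p t 0 _ b]ref_formC -!/(U _).
by congr (_ * _); ring.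
Qed.

Variables (kh : R) (u v : {poly R}).
Local Notation th := (kh * h).
Hypotheses (su : (size u <= p.+1)%N) (sv : (size v <= p.+1)%N).
Hypothesis quasi : conj_pair u.[1] v.[1] = expi th * conj_pair u.[0] v.[0].

(** The second difference in the cell index acts on the Bloch phases as
    multiplication by [2 - e^{i th} - e^{- i th}]. *)
Lemma cip_matrix_row (s : 'I_p) :
  let a := node ((s : nat)%:Z + p%:Z) in let b := node (s : nat)%:Z in
  let mu := penalty gamma th in
  \sum_(q < p) cip_matrix p gamma k h kh s q * bloch_coef p u v q =
  (h^-1)%:C * (expi (- th) * conj_pair (ref_form p t mu u a) (ref_form p t mu v a)
               + conj_pair (ref_form p t mu u b) (ref_form p t mu v b)).
Proof.
move=> a b mu.
pose P (q : 'I_p) m j := node ((q : nat)%:Z + (m - j) * p%:Z).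
have entry (q : 'I_p) m :
    cip_form p gamma k h (nodal_basis p h ((q : nat)%:Z + m * p%:Z)) (nodal_basis p h (s : nat)%:Z)
    = h^-1 * (ref_form p t 0 a (P q m (-1)) + ref_form p t 0 b (P q m 0)
    + gamma * (- top_coef p a * top_coef p (P q m (-2))
       + (2 * top_coef p a - top_coef p b) * top_coef p (P q m (-1))
       + (2 * top_coef p b - top_coef p a) * top_coef p (P q m 0)
       - top_coef p b * top_coef p (P q m 1))).
  have UP j : node_pieces R p ((q : nat)%:Z + m * p%:Z) j = P q m j.
    by rewrite /node_pieces /P; congr node_poly; ring.
  by rewrite cip_form_nodal // !UP.
have outside (q : 'I_p) m j : m \notin window -> -2 <= j <= 1 -> P q m j = 0.
  move=> mw jw; have qp : (q : nat)%:Z < p%:Z by rewrite ltz_nat.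
  have q0 : 0 <= (q : nat)%:Z by [].
  rewrite /P node_poly_out //.
  have H : m - j <= -1 \/ 2 <= m - j by move: mw; rewrite !inE; lia.
  by apply/orP; case: H => H; [left|right]; nia.
have mat (q : 'I_p) : cip_matrix p gamma k h kh s q = \sum_(m <- window)
   expi (m%:~R * th) * (cip_form p gamma k h (nodal_basis p h ((q : nat)%:Z + m * p%:Z))
     (nodal_basis p h (s : nat)%:Z))%:C.
  rewrite mxE (fsbig_int_window (s := window)) //.
    by apply: eq_bigr => m _; rewrite mulrA.
  by move=> m mw; rewrite entry !outside // !linear0 !(mulr0, addr0, subr0, rmorph0).
pose S (f : 'I_p -> int -> R) : R[i] := \sum_(q < p) (\sum_(m <- window)
   expi (m%:~R * th) * (f q m)%:C) * bloch_coef p u v q.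
have SD f g : S (fun q m => f q m + g q m) = S f + S g.
  rewrite /S -big_split /=; apply: eq_bigr => q _; rewrite -mulrDl -big_split /=.
  by congr (_ * _); apply: eq_bigr => m _; rewrite rmorphD mulrDr.
have SZ c f : S (fun q m => c * f q m) = c%:C * S f.
  rewrite /S mulr_sumr; apply: eq_bigr => q _; rewrite mulrA mulr_sumr.
  by congr (_ * _); apply: eq_bigr => m _; rewrite rmorphM mulrCA.
have SB f g : S (fun q m => f q m - g q m) = S f - S g.
  rewrite -mulN1r -(rmorphN1 (real_complex R)) -SZ -SD.
  by congr S; apply/funext => q; apply/funext => m; rewrite mulN1r.
have SE (F : {scalar {poly R}}) j : -2 <= j <= 1 ->
    S (fun q m => F (P q m j)) = expi (j%:~R * th) * conj_pair (F u) (F v).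
  exact: bloch_sum.
pose la := top_coef p a; pose lb := top_coef p b.
transitivity (S (fun q m => h^-1 * (ref_form p t 0 a (P q m (-1)) + ref_form p t 0 b (P q m 0)
    + gamma * (- la * top_coef p (P q m (-2)) + (2 * la - lb) * top_coef p (P q m (-1))
       + (2 * lb - la) * top_coef p (P q m 0) - lb * top_coef p (P q m 1))))).
  by apply: eq_bigr => q _; rewrite mat; congr (_ * _); apply: eq_bigr => m _; rewrite entry.
have SL f1 f2 y1 y2 y3 y4 c0 g c1 c2 c3 c4 :
    S (fun q m => c0 * (f1 q m + f2 q m + g * (c1 * y1 q m + c2 * y2 q m
         + c3 * y3 q m - c4 * y4 q m)))
    = c0%:C * (S f1 + S f2 + g%:C * (c1%:C * S y1 + c2%:C * S y2
         + c3%:C * S y3 - c4%:C * S y4)).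
  by rewrite SZ SD SD SZ SB SD SD !SZ.
rewrite (SL (fun q m => ref_form p t 0 a (P q m (-1))) (fun q m => ref_form p t 0 b (P q m 0))
  (fun q m => top_coef p (P q m (-2))) (fun q m => top_coef p (P q m (-1)))
  (fun q m => top_coef p (P q m 0)) (fun q m => top_coef p (P q m 1))).
rewrite (SE (ref_form p t 0 a)) // (SE (ref_form p t 0 b)) // !(SE (top_coef p)) //=.
have e0 : expi (0%:~R * th) = 1 by rewrite mul0r expi0.
have em1 : expi ((-1)%:~R * th) = expi (- th) by rewrite mulN1r.
have em2 : expi ((-2)%:~R * th) = expi (- th) * expi (- th).
  by rewrite -expiD; congr expi; ring.
have e1 : expi (1%:~R * th) = expi th by rewrite mul1r.
have ee : expi th * expi (- th) = 1 by rewrite -expiD subrr expi0.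
have ec : expi th + expi (- th) = (2 * cos th)%:C.
  rewrite /expi cosN sinN; apply/eqP; rewrite eq_complex /=.
  by apply/andP; split; apply/eqP; ring.
have muE : mu%:C = gamma%:C * (2 - (expi th + expi (- th))).
  by rewrite ec /mu /penalty rmorphM rmorphB rmorph_nat.
congr (_ * _); rewrite e0 em1 em2 e1.
have form w c : ref_form p t mu w c = ref_form p t 0 c w + mu * (top_coef p w * top_coef p c).
  by rewrite ref_form_mu ref_formC.
have cD x1 x2 y1 y2 c : conj_pair (x1 + mu * (x2 * c)) (y1 + mu * (y2 * c)) =
    conj_pair x1 y1 + (mu * c)%:C * conj_pair x2 y2.
  rewrite /conj_pair; apply/eqP; rewrite eq_complex /=.
  by apply/andP; split; apply/eqP; ring.
rewrite !form !cD -/la -/lb.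
move: (conj_pair _ _) (conj_pair _ _) (conj_pair _ _) => X1 X2 T; clearbody mu la lb.
rewrite !(rmorphM, rmorphB, rmorphN, rmorph_nat) /= muE.
apply/eqP; rewrite -subr_eq0; apply/eqP.
(* Both sides agree as polynomials in the phases once [e^{i th} e^{- i th} = 1]. *)
transitivity (gamma%:C * la%:C * X1 * (expi th * expi (- th) - 1)); first by ring.
by rewrite ee subrr mulr0.
Qed.

End Assembly.

(** * From discrete modes to discrete wave numbers *)

Section Kernel.
Local Open Scope classical_set_scope.
Local Open Scope ring_scope.
Local Open Scope complex_scope.
Variables (R : realType) (p : nat) (gamma k h kh : R).
Hypotheses (p0 : (0 < p)%N) (h0 : 0 < h).
Local Notation t := (k * h).
Local Notation th := (kh * h).
Local Notation node := (node_poly R p).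

Lemma conj_pair_cosn_shift j : conj_pair (cosn j (th / 2)) (cosn j.+1 (th / 2)) =
  expi th * conj_pair (cosn j (- (th / 2))) (cosn j.+1 (- (th / 2))).
Proof.
have E x : conj_pair (cosn j x) (cosn j.+1 x) = expi (x + j%:R * (pi / 2)).
  by rewrite /conj_pair cosnS opprK.
by rewrite !E -expiD; congr expi; rewrite addrA; congr (_ + _); field.
Qed.

(** The nodal values of [u - i v] form a kernel vector.  Rows of interior nodes
    vanish by harmonicity.  For the vertex row, the two one-sided contributions
    combine, after multiplication by the conjugate of the value at [0], into the
    energy of the mode, which is zero, and an antisymmetric imaginary part. *)
Lemma discrete_mode_det : discrete_mode p gamma t th ->
  discrete_wave_number p gamma k h kh.
Proof.
move=> [u [v [[su u0 u1 hu] [sv v0 v1 hv] E]]].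
have quasi : conj_pair u.[1] v.[1] = expi th * conj_pair u.[0] v.[0].
  by rewrite u0 v0 u1 v1 conj_pair_cosn_shift.
set mu := penalty gamma th in hu hv E.
have n0 : u.[0] ^+ 2 + v.[0] ^+ 2 = 1 by rewrite u0 v0 cosn_sqr.
have dec (w : {poly R}) : (size w <= p.+1)%N ->
    bubble p (w - (w.[0] *: node 0 + w.[1] *: node p%:Z)).
  move=> sw; have a0 i : (node i).[0] = (i == 0)%:R.
    by have := node_poly_sample R p0 i (leq0n p); rewrite ref_node0.
  have a1 i : (node i).[1] = (i == p%:Z)%:R.
    by have := node_poly_sample R p0 i (leqnn p); rewrite ref_node_p.
  have zp : (p%:Z == 0) = false by rewrite eqz_nat gtn_eqF.
  split.
  - rewrite (leq_trans (size_polyD _ _)) // geq_max sw size_polyN.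
    rewrite (leq_trans (size_polyD _ _)) // geq_max.
    by rewrite !(leq_trans (size_scale_leq _ _)) ?size_node_poly.
  - by rewrite !(hornerD, hornerN, hornerZ) !a0 eqxx zp mulr1 mulr0 addr0 subrr.
  - rewrite !(hornerD, hornerN, hornerZ) !a1 eqxx [0 == _]eq_sym zp.
    by rewrite mulr1 mulr0 add0r subrr.
have harm (w1 w2 : {poly R}) : harmonic p t mu w1 -> (size w2 <= p.+1)%N ->
    ref_form p t mu w1 w2 = w2.[0] * ref_form p t mu w1 (node 0)
      + w2.[1] * ref_form p t mu w1 (node p%:Z).
  move=> h1 s2; have := h1 _ (dec w2 s2).
  rewrite ref_formC ref_formBl ref_formDl !ref_formZl.
  by rewrite ![ref_form _ _ _ _ w1]ref_formC => /eqP; rewrite subr_eq0 => /eqP.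
have rows (s : 'I_p) : \sum_(q < p) cip_matrix p gamma k h kh s q * bloch_coef p u v q = 0.
  rewrite (cip_matrix_row gamma k p0 h0 su sv quasi) -/mu.
  have [s0|sn0] := eqVneq (s : nat) 0%N; last first.
    have bs : bubble p (node (s : nat)%:Z).
      split; first exact: size_node_poly.
        have := node_poly_sample R p0 (s : nat)%:Z (leq0n p); rewrite ref_node0 => ->.
        by rewrite eqz_nat (negPf sn0).
      have := node_poly_sample R p0 (s : nat)%:Z (leqnn p); rewrite ref_node_p // => ->.
      by rewrite eqz_nat ltn_eqF.
    rewrite (@node_poly_out R p ((s : nat)%:Z + p%:Z)); last first.
      by apply/orP; right; rewrite ltrDr ltz_nat lt0n.
    rewrite !linear0 (hu _ bs) (hv _ bs) /conj_pair oppr0 -[0 +i* 0]/(0 : R[i]).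
    by rewrite mulr0 addr0 mulr0.
  rewrite s0 add0r.
  have Wn0 : u.[0] +i* v.[0] != 0.
    apply/eqP => - [x0 y0]; move: n0; rewrite x0 y0 expr0n addr0 => /eqP.
    by rewrite eq_sym oner_eq0.
  set X1 := conj_pair _ _; set X0 := conj_pair _ _.
  suff : (u.[0] +i* v.[0]) * (expi (- th) * X1 + X0) = 0.
    by move=> /eqP; rewrite mulf_eq0 (negPf Wn0) => /eqP ->; rewrite mulr0.
  have W1 : (u.[0] +i* v.[0]) * expi (- th) = u.[1] +i* v.[1].
    have cj (x : R[i]) (y : R[i]) : (x * y)^* = x^* * y^* by rewrite rmorphM.
    have conjE (x y : R) : (conj_pair x y)^* = x +i* y by rewrite /conj_pair /= opprK.
    rewrite -!conjE quasi cj mulrC; congr (_ * _).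
    by rewrite /expi /= cosN sinN.
  rewrite mulrDr mulrA W1 /X1 /X0 /conj_pair.
  apply/eqP; rewrite eq_complex /=; apply/andP; split; apply/eqP.
    by rewrite -[RHS]E (harm u u) // (harm v v) //; ring.
  transitivity (ref_form p t mu u v - ref_form p t mu v u).
    by rewrite (harm u v) // (harm v u) //; ring.
  by rewrite ref_formC subrr.
rewrite /discrete_wave_number -det_tr; apply/eqP/det0P.
exists (\row_q bloch_coef p u v q).
  apply/eqP => /rowP /(_ (Ordinal p0)); rewrite !mxE /bloch_coef ref_node0 => -[x0 /eqP].
  rewrite oppr_eq0 => /eqP y0; move: n0; rewrite x0 y0 expr0n addr0 => /eqP.
  by rewrite eq_sym oner_eq0.
apply/rowP => s; rewrite !mxE -[RHS](rows s); apply: eq_bigr => q _.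
by rewrite !mxE mulrC.
Qed.

End Kernel.

Theorem theorem3p1 (R : realType) (p : nat) (gamma : R) (hp : (1 <= p)%N) :
  exists C0 C : R, 0 < C0 /\ 0 < C /\
    forall k h : R, 0 < k -> 0 < h -> k * h / p%:R <= C0 ->
      exists kh : R,
        [/\ 0 < kh,
            discrete_wave_number p gamma k h kh,
            `| `|k - kh|
               - 2^-1 * `| (2 * p + 1)%:R^-1
                            * ((p`!)%:R / ((2 * p)`!)%:R) ^+ 2 + gamma |
                 * k ^+ (2 * p + 1) * h ^+ (2 * p) |
              <= C * (k ^+ (2 * p + 3) * h ^+ (2 * p + 2))
          & gamma = gamma0 R p ->
            `|k - kh| <= C * (k ^+ (2 * p + 3) * h ^+ (2 * p + 2)) ].
Proof.
have [d [C [d0 C0 H]]] := discrete_root gamma hp.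
have pR : 0 < p%:R :> R by rewrite ltr0n.
exists (d / p%:R), C; split; first exact: divr_gt0.
split=> // k h k0 h0; rewrite ler_pM2r ?invr_gt0 // => khd.
have t0 : 0 < k * h by exact: mulr_gt0.
have [th [th0 dm est]] := H (k * h) (introT andP (conj t0 khd)).
have hn0 : h != 0 by rewrite gt_eqF.
have main : `| `|k - th / h| - 2^-1 * `|phase_coef p gamma|
      * k ^+ (2 * p + 1) * h ^+ (2 * p)| <= C * (k ^+ (2 * p + 3) * h ^+ (2 * p + 2)).
  rewrite -(ler_pM2r h0) -[X in _ * X <= _](gtr0_norm h0) -normrM mulrBl.
  rewrite -[X in _ * X - _](gtr0_norm h0) -normrM mulrBl mulfVK //.
  move: est; rewrite !exprMn; congr (`| _ - _ | <= _).
    by rewrite addn1 [h ^+ _.+1]exprS; ring.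
  have e3 : (2 * p + 3)%N = (2 * p + 2).+1 by rewrite addnS.
  rewrite -[C * _ * h]mulrA -[_ * _ * h]mulrA -exprSr -e3.
  by [].
exists (th / h); split.
- exact: divr_gt0.
- by apply: discrete_mode_det => //; rewrite mulfVK.
- exact: main.
- move=> g0; move: main.
  rewrite (_ : phase_coef p gamma = 0); last by rewrite /phase_coef g0 /gamma0 subrr.
  by rewrite normr0 mulr0 !mul0r subr0 normr_id.
Qed.
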